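(* Let $\mathcal M$ be a partial GW*-algebra on a dense subspace $\mathcal D$ of a Hilbert space $\mathcal H$, and let $E$ be a projection with $E\restriction_{\mathcal D}\in\mathcal M$ and $E\mathcal D\subset\mathcal D$. Then the full closure of $\mathcal M_E=\{EX\restriction_{E\mathcal D}:X\in\mathcal M\}$ is a partial GW*-algebra on $\widehat{\mathcal D}(\mathcal M_E)$.
   Context: $\mathcal L^\dagger(\mathcal D,\mathcal H)$ is the set of linear operators $X$ with $D(X)=\mathcal D$, $D(X^* )\supseteq\mathcal D$, with involution $X^\dagger=X^*\restriction_{\mathcal D}$, and weak partial multiplication $X_1\,\square\, X_2={X_1^\dagger}^*X_2$, defined iff $X_2\mathcal D\subset D({X_1^\dagger}^* )$ and $X_1^*\mathcal D\subset D(X_2^* )$. An O*-vector space is a $\dagger$-invariant subspace of $\mathcal L^\dagger(\mathcal D,\mathcal H)$; a (weak) partial O*-algebra is an O*-vector space closed under $\square$ whenever defined. For an O*-vector space $\mathcal M$: $\widehat{\mathcal D}(\mathcal M)=\bigcap_{X\in\mathcal M}D(\overline X)$, the full closure is $\widehat{\mathcal M}=\{\overline X\restriction_{\widehat{\mathcal D}(\mathcal M)}:X\in\mathcal M\}$ on $\widehat{\mathcal D}(\mathcal M)$, and $\mathcal M$ is fully closed if $\widehat{\mathcal D}(\mathcal M)=\mathcal D$. Weak commutant: $\mathcal M'_{\rm w}=\{C\in\mathcal B(\mathcal H):\langle CX\xi,\eta\rangle=\langle C\xi,X^\dagger\eta\rangle\ \forall X\in\mathcal M,\ \xi,\eta\in\mathcal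 D\}$. Unbounded bicommutant: $\mathcal M''_{{\rm w}\sigma}=\{X\in\mathcal L^\dagger(\mathcal D,\mathcal H):\langle CX\xi,\eta\rangle=\langle C\xi,X^\dagger\eta\rangle\ \forall C\in\mathcal M'_{\rm w},\ \xi,\eta\in\mathcal D\}$. A fully closed partial O*-algebra $\mathcal M$ on $\mathcal D$ is a partial GW*-algebra if $\mathcal M'_{\rm w}\mathcal D\subset\mathcal D$ and $\mathcal M=\mathcal M''_{{\rm w}\sigma}$. *)

(* Defs.v *)
From Stdlib Require Import Reals.
Open Scope R_scope.

Record C : Type := mkC { Cre : R; Cim : R }.
Definition C0 : C := mkC 0 0.
Definition C1 : C := mkC 1 0.
Definition Cadd (a b : C) : C := mkC (Cre a + Cre b) (Cim a + Cim b).
Definition Cmul (a b : C) : C :=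
  mkC (Cre a * Cre b - Cim a * Cim b) (Cre a * Cim b + Cim a * Cre b).
Definition Cconj (a : C) : C := mkC (Cre a) (- Cim a).

Record HilbertSpace : Type := {
  hcar :> Type;
  hzero : hcar;
  hadd : hcar -> hcar -> hcar;
  hopp : hcar -> hcar;
  hscal : C -> hcar -> hcar;
  hinner : hcar -> hcar -> C;
  hadd_assoc : forall x y z, hadd x (hadd y z) = hadd (hadd x y) z;
  hadd_comm : forall x y, hadd x y = hadd y x;
  hadd_0 : forall x, hadd x hzero = x;
  hadd_opp : forall x, hadd x (hopp x) = hzero;
  hscal_assoc : forall a b x, hscal a (hscal b x) = hscal (Cmul a b) x;
  hscal_1 : forall x, hscal C1 x = x;
  hscal_addv : forall a x y, hscal a (hadd x y) = hadd (hscal a x) (hscal a y);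
  hscal_adds : forall a b x, hscal (Cadd a b) x = hadd (hscal a x) (hscal b x);
  hinner_addl : forall x y z, hinner (hadd x y) z = Cadd (hinner x z) (hinner y z);
  hinner_scall : forall a x z, hinner (hscal a x) z = Cmul a (hinner x z);
  hinner_conj : forall x y, hinner y x = Cconj (hinner x y);
  hinner_pos : forall x, 0 <= Cre (hinner x x);
  hinner_def : forall x, hinner x x = C0 -> x = hzero;
  hcomplete : forall u : nat -> hcar,
    (forall eps, 0 < eps -> exists N, forall m n, (N <= m)%nat -> (N <= n)%nat ->
       sqrt (Cre (hinner (hadd (u m) (hopp (u n))) (hadd (u m) (hopp (u n))))) < eps) ->
    exists l, forall eps, 0 < eps -> exists N, forall n, (N <= n)%nat ->
       sqrt (Cre (hinner (hadd (u n) (hopp l)) (hadd (u n) (hopp l)))) < eps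
}.
Arguments hzero {h}.
Arguments hadd {h} _ _.
Arguments hopp {h} _.
Arguments hscal {h} _ _.
Arguments hinner {h} _ _.

Section Defs.
Variable H : HilbertSpace.

Definition hsub (x y : H) : H := hadd x (hopp y).
Definition hnorm (x : H) : R := sqrt (Cre (hinner x x)).
Definition hdist (x y : H) : R := hnorm (hsub x y).

Definition set_eq (A B : H -> Prop) : Prop := forall x, A x <-> B x.
Definition subspace (K : H -> Prop) : Prop :=
  K hzero /\ (forall x y, K x -> K y -> K (hadd x y)) /\
  (forall a x, K x -> K (hscal a x)).
Definition closed_set (K : H -> Prop) : Prop :=
  forall x, (forall eps, 0 < eps -> exists y, K y /\ hdist x y < eps) -> K x.
Definition dense_in (K D : H -> Prop) : Prop :=
  forall x, K x -> forall eps, 0 < eps -> exists y, D y /\ hdist x y < eps.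

(* (possibly unbounded) operators, represented by their graphs *)
Definition op : Type := H -> H -> Prop.
Definition opdom (X : op) : H -> Prop := fun x => exists y, X x y.
Definition op_eq (X Y : op) : Prop := forall x y, X x y <-> Y x y.
Definition inS (M : op -> Prop) (X : op) : Prop := exists Y, M Y /\ op_eq Y X.

Definition linop (X : op) : Prop :=
  (forall x y y', X x y -> X x y' -> y = y') /\ X hzero hzero /\
  (forall x y x' y', X x y -> X x' y' -> X (hadd x x') (hadd y y')) /\
  (forall a x y, X x y -> X (hscal a x) (hscal a y)).

(* adjoint of X as an operator in the Hilbert space K (a closed subspace of H) *)
Definition adjK (K : H -> Prop) (X : op) : op :=
  fun eta zeta => K eta /\ K zeta /\
    forall xi y, X xi y -> hinner y eta = hinner xi zeta.
Definition restr (X : op) (D : H -> Prop) : op := fun x y => D x /\ X x y.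
Definition dag (K D : H -> Prop) (X : op) : op := restr (adjK K X) D.

Definition Ldag (K D : H -> Prop) (X : op) : Prop :=
  set_eq (opdom X) D /\ linop X /\ (forall x y, X x y -> K y) /\
  (forall eta, D eta -> opdom (adjK K X) eta).

(* standing setting: K closed subspace (the Hilbert space), D dense subspace of K *)
Definition setting (K D : H -> Prop) : Prop :=
  subspace K /\ closed_set K /\ subspace D /\ (forall x, D x -> K x) /\ dense_in K D.

Definition op_add (X Y : op) : op :=
  fun x z => exists y1 y2, X x y1 /\ Y x y2 /\ z = hadd y1 y2.
Definition op_scal (a : C) (X : op) : op := fun x z => exists y, X x y /\ z = hscal a y.
Definition op_zero (D : H -> Prop) : op := fun x z => D x /\ z = hzero.

Definition Ostar_vs (K D : H -> Prop) (M : op -> Prop) : Prop :=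
  setting K D /\ (forall X, M X -> Ldag K D X) /\ inS M (op_zero D) /\
  (forall X Y, M X -> M Y -> inS M (op_add X Y)) /\
  (forall a X, M X -> inS M (op_scal a X)) /\
  (forall X, M X -> inS M (dag K D X)).

Definition wmul_defined (K D : H -> Prop) (X1 X2 : op) : Prop :=
  (forall xi y, X2 xi y -> opdom (adjK K (dag K D X1)) y) /\
  (forall eta z, dag K D X1 eta z -> opdom (adjK K X2) z).
Definition wmul (K D : H -> Prop) (X1 X2 : op) : op :=
  fun xi z => exists y, X2 xi y /\ adjK K (dag K D X1) y z.

Definition partial_Oalg (K D : H -> Prop) (M : op -> Prop) : Prop :=
  Ostar_vs K D M /\
  forall X1 X2, M X1 -> M X2 -> wmul_defined K D X1 X2 -> inS M (wmul K D X1 X2).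

Definition op_closure (X : op) : op :=
  fun x y => forall eps, 0 < eps ->
    exists x' y', X x' y' /\ hdist x x' < eps /\ hdist y y' < eps.
Definition Dhat (M : op -> Prop) : H -> Prop :=
  fun x => forall X, M X -> opdom (op_closure X) x.
Definition full_closure (M : op -> Prop) : op -> Prop :=
  fun Y => exists X, M X /\ op_eq Y (restr (op_closure X) (Dhat M)).
Definition fully_closed (D : H -> Prop) (M : op -> Prop) : Prop := set_eq (Dhat M) D.

(* bounded operators on K, represented by functions H -> H (values off K irrelevant) *)
Definition boundedK (K : H -> Prop) (Cf : H -> H) : Prop :=
  (forall x, K x -> K (Cf x)) /\
  (forall x y, K x -> K y -> Cf (hadd x y) = hadd (Cf x) (Cf y)) /\
  (forall a x, K x -> Cf (hscal a x) = hscal a (Cf x)) /\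
  exists c, forall x, K x -> hnorm (Cf x) <= c * hnorm x.

Definition weak_commutant (K D : H -> Prop) (M : op -> Prop) (Cf : H -> H) : Prop :=
  boundedK K Cf /\
  forall X xi eta y z, M X -> D xi -> D eta -> X xi y -> dag K D X eta z ->
    hinner (Cf y) eta = hinner (Cf xi) z.

Definition bicommutant (K D : H -> Prop) (M : op -> Prop) (X : op) : Prop :=
  Ldag K D X /\
  forall Cf, weak_commutant K D M Cf ->
    forall xi eta y z, D xi -> D eta -> X xi y -> dag K D X eta z ->
      hinner (Cf y) eta = hinner (Cf xi) z.

Definition partial_GW (K D : H -> Prop) (M : op -> Prop) : Prop :=
  partial_Oalg K D M /\ fully_closed D M /\
  (forall Cf xi, weak_commutant K D M Cf -> D xi -> D (Cf xi)) /\
  (forall X, inS M X <-> bicommutant K D M X).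

Definition projection (E : H -> H) : Prop :=
  boundedK (fun _ => True) E /\ (forall x, E (E x) = E x) /\
  (forall x y, hinner (E x) y = hinner x (E y)).
Definition graph (f : H -> H) : op := fun x y => y = f x.
Definition range (E : H -> H) : H -> Prop := fun x => exists y, x = E y.
Definition image (E : H -> H) (D : H -> Prop) : H -> Prop :=
  fun x => exists d, D d /\ x = E d.
Definition reduced (E : H -> H) (D : H -> Prop) (M : op -> Prop) : op -> Prop :=
  fun Y => exists X, M X /\
    op_eq Y (fun xi z => image E D xi /\ exists y, X xi y /\ z = E y).

End Defs.

(* Main.v *)
From Stdlib Require Import Reals Lra Lia Classical ClassicalEpsilon.
Require Import Defs.

(** Everything hinges on [(M_E)'_w] leaving the domain of the closure of each [Y] in [M_E]
    invariant. Let [P] be the projection of [H * H] onto the closed graph [V] of [Y]. The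
    *-invariant set [M'_w] maps [D] into [D], hence commutes with [E], and [V] is invariant
    under its diagonal action; so the four matrix entries of [P] commute with [M'_w], and
    their restrictions to [D] belong to [M''_wsigma = M]. They also take their values in [E H],
    so any [C] in [(M_E)'_w] commutes with them on [E H]; thus [C] preserves [V], which is the
    invariance, obtained without the identity [(M_E)'_w = (M'_w)_E].

    If [X] lies in the bicommutant of the full closure of [M_E], then [X E] restricted to [D] is
    in [M''_wsigma = M] and [X] is the closure of its reduction, restricted to the full
    domain. Closure under the weak product follows, since weak products of elements always
    lie in the bicommutant when the commutant leaves the domain invariant. *)

(** * Complex arithmetic and inner product identities *)

Lemma C_ext (a b : C) : Cre a = Cre b -> Cim a = Cim b -> a = b.
Proof. destruct a, b; simpl; intros -> ->; reflexivity. Qed.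

Ltac C_ring := apply C_ext; simpl; ring.

Section HilbertBasics.
Variable H : HilbertSpace.
#[local] Arguments hsub {H}.
Implicit Types (x y z : H).

Lemma inner_addr x y z : hinner x (hadd y z) = Cadd (hinner x y) (hinner x z).
Proof.
  rewrite (hinner_conj _ (hadd y z) x), (hinner_conj _ y x), (hinner_conj _ z x), hinner_addl.
  C_ring.
Qed.

Lemma inner_scalr a x y : hinner x (hscal a y) = Cmul (Cconj a) (hinner x y).
Proof.
  rewrite (hinner_conj _ (hscal a y) x), (hinner_conj _ y x), hinner_scall. C_ring.
Qed.

Lemma inner_zerol x : hinner hzero x = C0.
Proof.
  pose proof (hinner_addl H hzero hzero x) as h. rewrite hadd_0 in h.
  destruct (hinner hzero x) as [a b]. injection h; intros.
  apply C_ext; simpl; lra.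
Qed.

Lemma inner_oppl x z : hinner (hopp x) z = Cmul (mkC (-1) 0) (hinner x z).
Proof.
  pose proof (hinner_addl H x (hopp x) z) as h. rewrite hadd_opp, inner_zerol in h.
  destruct (hinner (hopp x) z) as [a b], (hinner x z) as [c d]. injection h; intros.
  apply C_ext; simpl; lra.
Qed.

Lemma inner_zeror x : hinner x hzero = C0.
Proof. rewrite hinner_conj, inner_zerol. C_ring. Qed.

Lemma inner_oppr x z : hinner x (hopp z) = Cmul (mkC (-1) 0) (hinner x z).
Proof. rewrite (hinner_conj _ (hopp z)), inner_oppl, (hinner_conj _ z x). C_ring. Qed.

Lemma inner_subl x y z : hinner (hsub x y) z = Cadd (hinner x z) (Cmul (mkC (-1) 0) (hinner y z)).
Proof. unfold hsub. rewrite hinner_addl, inner_oppl. reflexivity. Qed.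

Lemma inner_subr x y z : hinner x (hsub y z) = Cadd (hinner x y) (Cmul (mkC (-1) 0) (hinner x z)).
Proof. unfold hsub. rewrite inner_addr, inner_oppr. reflexivity. Qed.

Lemma sub_eq0 x y : hsub x y = hzero -> x = y.
Proof.
  unfold hsub; intro h.
  rewrite <- (hadd_0 _ x), <- (hadd_opp _ y), (hadd_comm _ y), hadd_assoc, h.
  rewrite hadd_comm; apply hadd_0.
Qed.

Lemma inner_ext x y : (forall z, hinner x z = hinner y z) -> x = y.
Proof.
  intro h. apply sub_eq0, hinner_def. rewrite inner_subl, h. C_ring.
Qed.
End HilbertBasics.

Ltac inner_expand :=
  rewrite ?inner_subl, ?inner_subr, ?hinner_addl, ?inner_addr, ?hinner_scall, ?inner_scalr,
    ?inner_oppl, ?inner_oppr, ?inner_zerol, ?inner_zeror.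
(* Vector identities are proved by testing against all vectors, which turns them
   into ring identities between real and imaginary parts of inner products. *)
Ltac vec_ring := apply inner_ext; intro; repeat progress inner_expand; C_ring.

(** * Norms, convergent sequences and closures of graphs *)

Section HilbertNorm.
Variable H : HilbertSpace.
#[local] Arguments hsub {H}.
#[local] Arguments hnorm {H}.
#[local] Arguments hdist {H}.
#[local] Arguments subspace {H}.
#[local] Arguments closed_set {H}.
#[local] Arguments dense_in {H}.
#[local] Arguments boundedK {H}.
#[local] Arguments op_closure {H}.
Implicit Types (x y z : H) (u v : nat -> H) (K D : H -> Prop).

Lemma opp_scal x : hopp x = hscal (mkC (-1) 0) x.
Proof. vec_ring. Qed.

Lemma subspace_sub K x y : subspace K -> K x -> K y -> K (hsub x y).
Proof.
  intros (_ & ha & hs) hx hy. unfold hsub. rewrite opp_scal. auto.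
Qed.

Lemma inner_self_im x : Cim (hinner x x) = 0.
Proof.
  pose proof (f_equal Cim (hinner_conj _ x x)) as h; simpl in h; lra.
Qed.

(** Turns an imaginary part into a real part of another inner product, so that limits and
    orthogonality need only be treated for real parts. *)
Lemma inner_im x y : Cim (hinner x y) = Cre (hinner x (hscal (mkC 0 1) y)).
Proof. rewrite inner_scalr; simpl; ring. Qed.

Lemma norm_ge0 x : 0 <= hnorm x.
Proof. apply sqrt_pos. Qed.

Lemma norm_sq x : hnorm x * hnorm x = Cre (hinner x x).
Proof. apply sqrt_sqrt, hinner_pos. Qed.

Lemma norm_zero : hnorm (hzero : H) = 0.
Proof. unfold hnorm. rewrite inner_zerol. apply sqrt_0. Qed.

Lemma norm_eq0 x : hnorm x = 0 -> x = hzero.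
Proof.
  intro h. apply hinner_def, C_ext; [|apply inner_self_im].
  rewrite <- norm_sq, h. simpl; ring.
Qed.

Lemma norm_le_sq x (r : R) : 0 <= r -> Cre (hinner x x) <= r * r -> hnorm x <= r.
Proof.
  intros h0 h. pose proof (norm_ge0 x). rewrite <- norm_sq in h. nra.
Qed.

Lemma cauchy_schwarz x y : Rabs (Cre (hinner x y)) <= hnorm x * hnorm y.
Proof.
  pose proof (norm_ge0 x) as hx. pose proof (norm_ge0 y) as hy.
  pose proof (norm_sq x) as sx. pose proof (norm_sq y) as sy.
  set (a := hnorm x) in *; set (b := hnorm y) in *.
  assert (q : forall s t : R, 0 <= s * s * (a * a) + 2 * s * t * Cre (hinner x y) + t * t * (b * b)).
  { intros s t. rewrite sx, sy.
    pose proof (hinner_pos _ (hadd (hscal (mkC s 0) x) (hscal (mkC t 0) y))) as h.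
    rewrite !hinner_addl, !inner_addr, !hinner_scall, !inner_scalr, (hinner_conj _ x y) in h.
    simpl in h. nra. }
  destruct (Req_dec a 0) as [ha|ha].
  { assert (x = hzero) as -> by (apply norm_eq0; exact ha).
    rewrite inner_zerol; simpl. rewrite Rabs_R0. nra. }
  destruct (Req_dec b 0) as [hb|hb].
  { assert (y = hzero) as -> by (apply norm_eq0; exact hb).
    rewrite inner_zeror; simpl. rewrite Rabs_R0. nra. }
  assert (0 < a * b) by (apply Rmult_lt_0_compat; lra).
  (* The form at [(b, a)] and [(b, -a)] equals 2ab(ab ± Re<x,y>); dividing by 2ab > 0 gives both
     bounds. *)
  pose proof (q b a) as h1. pose proof (q b (-a)) as h2.
  apply Rabs_le. split; nra.
Qed.

Lemma norm_add x y : hnorm (hadd x y) <= hnorm x + hnorm y.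
Proof.
  pose proof (norm_ge0 x). pose proof (norm_ge0 y).
  apply norm_le_sq; [lra|].
  rewrite hinner_addl, !inner_addr; simpl. rewrite (hinner_conj _ x y); simpl.
  pose proof (Rle_trans _ _ _ (Rle_abs _) (cauchy_schwarz x y)).
  rewrite <- (norm_sq x), <- (norm_sq y). nra.
Qed.

Lemma norm_scal a x : hnorm (hscal a x) = sqrt (Cre a * Cre a + Cim a * Cim a) * hnorm x.
Proof.
  unfold hnorm. rewrite <- sqrt_mult; [|nra|apply hinner_pos].
  f_equal. rewrite hinner_scall, inner_scalr; simpl. ring.
Qed.

Lemma norm_sub_sym x y : hnorm (hsub x y) = hnorm (hsub y x).
Proof.
  unfold hnorm. f_equal. rewrite !inner_subl, !inner_subr; simpl. ring.
Qed.

Lemma dist_triangle x y z : hdist x z <= hdist x y + hdist y z.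
Proof.
  unfold hdist. replace (hsub x z) with (hadd (hsub x y) (hsub y z)) by vec_ring.
  apply norm_add.
Qed.

(** Phrased as a real sequence tending to 0, which makes the limit theorems for real sequences
    available. *)
Definition conv u x : Prop := Un_cv (fun n => hdist x (u n)) 0.

Lemma dist_ge0 x y : 0 <= hdist x y.
Proof. apply norm_ge0. Qed.

Lemma Un_cv0_le (a b : nat -> R) :
  (forall n, 0 <= a n <= b n) -> Un_cv b 0 -> Un_cv a 0.
Proof.
  intros h hb eps he. destruct (hb eps he) as [N hN]. exists N; intros n hn.
  specialize (hN n hn). unfold Rdist in *. specialize (h n).
  rewrite Rminus_0_r, Rabs_pos_eq in *; lra.
Qed.

Lemma conv_of_inv u x : (forall n, hdist x (u n) < / INR (S n)) -> conv u x.
Proof.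
  intros h. apply (Un_cv0_le _ (fun n => / INR (S n))).
  - intro n. split; [apply dist_ge0 | specialize (h n); lra].
  - intros eps he. destruct (archimed_cor1 eps he) as (N & hN & hN0).
    exists N; intros n hn. unfold Rdist. rewrite Rminus_0_r, Rabs_pos_eq.
    + eapply Rle_lt_trans; [|exact hN]. apply Rinv_le_contravar; [apply lt_0_INR; lia|].
      apply le_INR; lia.
    + left. apply Rinv_0_lt_compat, lt_0_INR; lia.
Qed.

Lemma inv_INR_pos n : 0 < / INR (S n).
Proof. apply Rinv_0_lt_compat, lt_0_INR; lia. Qed.

Lemma conv_eps u x eps : conv u x -> 0 < eps -> exists N, forall n, (N <= n)%nat -> hdist x (u n) < eps.
Proof.
  intros h he. destruct (h eps he) as [N hN]. exists N; intros n hn. specialize (hN n hn).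
  unfold Rdist in hN. rewrite Rminus_0_r, Rabs_pos_eq in hN; [exact hN | apply dist_ge0].
Qed.

Lemma conv_const x : conv (fun _ => x) x.
Proof.
  apply conv_of_inv; intro n. unfold hdist. replace (hsub x x) with (hzero : H) by vec_ring.
  rewrite norm_zero. apply inv_INR_pos.
Qed.

Lemma conv_add u v x y : conv u x -> conv v y -> conv (fun n => hadd (u n) (v n)) (hadd x y).
Proof.
  intros hu hv.
  apply (Un_cv0_le _ (fun n => hdist x (u n) + hdist y (v n))).
  - intro n. split; [apply dist_ge0|]. unfold hdist.
    replace (hsub (hadd x y) (hadd (u n) (v n))) with (hadd (hsub x (u n)) (hsub y (v n)))
      by vec_ring.
    apply norm_add.
  - rewrite <- (Rplus_0_r 0). apply (CV_plus _ _ _ _ hu hv).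
Qed.

Lemma conv_lip (f : H -> H) (c : R) u x :
  (forall n, hdist (f x) (f (u n)) <= c * hdist x (u n)) ->
  conv u x -> conv (fun n => f (u n)) (f x).
Proof.
  intros hf hu. apply (Un_cv0_le _ (fun n => c * hdist x (u n))).
  - intro n. split; [apply dist_ge0 | apply hf].
  - rewrite <- (Rmult_0_r c).
    apply (CV_mult (fun _ => c)); [|exact hu].
    intros e he; exists 0%nat; intros. unfold Rdist. rewrite Rminus_diag, Rabs_R0. exact he.
Qed.

Lemma conv_scal a u x : conv u x -> conv (fun n => hscal a (u n)) (hscal a x).
Proof.
  apply conv_lip with (c := sqrt (Cre a * Cre a + Cim a * Cim a)). intro n.
  unfold hdist. replace (hsub (hscal a x) (hscal a (u n))) with (hscal a (hsub x (u n))) by vec_ring.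
  rewrite norm_scal. apply Rle_refl.
Qed.

Lemma bounded_sub K (Cf : H -> H) x y :
  subspace K -> boundedK K Cf -> K x -> K y -> Cf (hsub x y) = hsub (Cf x) (Cf y).
Proof.
  intros (_ & _ & hs) (_ & ha & hsc & _) hx hy. unfold hsub. rewrite !opp_scal.
  rewrite ha, hsc; auto.
Qed.

Lemma bounded_zero K (Cf : H -> H) : subspace K -> boundedK K Cf -> Cf hzero = hzero.
Proof.
  intros (hz & _) (_ & _ & hsc & _).
  replace (hzero : H) with (hscal C0 (hzero : H)) at 1 by vec_ring. rewrite hsc by auto. vec_ring.
Qed.

Lemma bounded_conv K (Cf : H -> H) u x :
  subspace K -> boundedK K Cf -> (forall n, K (u n)) -> K x ->
  conv u x -> conv (fun n => Cf (u n)) (Cf x).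
Proof.
  intros hK hC hu hx. destruct (hC) as (_ & _ & _ & c & hc).
  apply conv_lip with (c := c). intro n. unfold hdist.
  rewrite <- (bounded_sub K) by auto. apply hc. apply subspace_sub; auto.
Qed.

Lemma conv_re u v x y :
  conv u x -> conv v y -> Un_cv (fun n => Cre (hinner (u n) (v n))) (Cre (hinner x y)).
Proof.
  intros hu hv.
  (* Writing d = x - u n and e = y - v n, the difference of <x,y> and <u n,v n> is <x,e> + <d,y> -
     <d,e>; Cauchy-Schwarz bounds its real part by [b n]. *)
  set (b := fun n => hdist x (u n) * hdist y (v n) + (hdist x (u n) * hnorm y + hnorm x * hdist y (v n))).
  assert (hb : Un_cv b 0).
  { assert (cst : forall r : R, Un_cv (fun _ => r) r).
    { intros r e he; exists 0%nat; intros. unfold Rdist. rewrite Rminus_diag, Rabs_R0. exact he. }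
    replace 0 with (0 * 0 + (0 * hnorm y + hnorm x * 0)) by ring.
    apply (CV_plus (fun n => hdist x (u n) * hdist y (v n))
             (fun n => hdist x (u n) * hnorm y + hnorm x * hdist y (v n))).
    - apply (CV_mult _ _ _ _ hu hv).
    - apply (CV_plus (fun n => hdist x (u n) * hnorm y) (fun n => hnorm x * hdist y (v n))).
      + apply (CV_mult _ (fun _ => hnorm y) _ _ hu (cst _)).
      + apply (CV_mult (fun _ => hnorm x) _ _ _ (cst _) hv). }
  intros eps he. destruct (hb eps he) as [N hN]. exists N; intros n hn.
  specialize (hN n hn). unfold Rdist in *. rewrite Rminus_0_r in hN.
  apply Rle_lt_trans with (2 := hN). eapply Rle_trans; [|apply Rle_abs]. unfold b, hdist.
  pose proof (cauchy_schwarz (hsub x (u n)) (hsub y (v n))) as h1.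
  pose proof (cauchy_schwarz (hsub x (u n)) y) as h2.
  pose proof (cauchy_schwarz x (hsub y (v n))) as h3.
  rewrite !inner_subl, !inner_subr in *; simpl in *.
  unfold Rabs in *. repeat destruct Rcase_abs; lra.
Qed.

(** The form in which identities between inner products pass to limits; constant sequences cover
    fixed arguments. *)
Lemma conv_inner u v u' v' x y x' y' :
  conv u x -> conv v y -> conv u' x' -> conv v' y' ->
  (forall n, hinner (u n) (v n) = hinner (u' n) (v' n)) -> hinner x y = hinner x' y'.
Proof.
  intros hu hv hu' hv' h. apply C_ext.
  - apply (UL_sequence _ _ _ (conv_re _ _ _ _ hu hv)).
    intros e he. destruct (conv_re _ _ _ _ hu' hv' e he) as [N hN].
    exists N; intros n hn. rewrite h. auto.
  - rewrite !inner_im.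
    apply (UL_sequence _ _ _ (conv_re _ _ _ _ hu (conv_scal _ _ _ hv))).
    intros e he. destruct (conv_re _ _ _ _ hu' (conv_scal (mkC 0 1) _ _ hv') e he) as [N hN].
    exists N; intros n hn. rewrite inner_scalr, h, <- inner_scalr. auto.
Qed.

Lemma conv_unique u x y : conv u x -> conv u y -> x = y.
Proof.
  intros hx hy. apply inner_ext; intro z.
  apply (conv_inner u (fun _ => z) u (fun _ => z)); auto using conv_const.
Qed.

Lemma closed_conv K u x : closed_set K -> (forall n, K (u n)) -> conv u x -> K x.
Proof.
  intros hK hu hx. apply hK. intros e he. destruct (conv_eps u x e hx he) as [N hN].
  exists (u N); split; auto.
Qed.

(** Countable choice of points of [K] within 1/(n+1) of [x] gives a sequence in [K] converging to
    [x]. *)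
Lemma closed_set_conv K :
  (forall u x, (forall n, K (u n)) -> conv u x -> K x) -> closed_set K.
Proof.
  intros h x hx.
  assert (hs : forall n, exists y, K y /\ hdist x y < / INR (S n)).
  { intro n; apply hx, inv_INR_pos. }
  set (u := fun n => proj1_sig (constructive_indefinite_description _ (hs n))).
  assert (hu : forall n, K (u n) /\ hdist x (u n) < / INR (S n)).
  { intro n. unfold u. apply proj2_sig. }
  apply (h u); [apply hu | apply conv_of_inv; apply hu].
Qed.

Lemma dense_conv K D x : dense_in K D -> K x -> exists u, (forall n, D (u n)) /\ conv u x.
Proof.
  intros h hx.
  assert (hs : forall n, exists y, D y /\ hdist x y < / INR (S n)).
  { intro n; apply h; auto using inv_INR_pos. }
  set (u := fun n => proj1_sig (constructive_indefinite_description _ (hs n))).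
  assert (hu : forall n, D (u n) /\ hdist x (u n) < / INR (S n)).
  { intro n. unfold u. apply proj2_sig. }
  exists u; split; [apply hu | apply conv_of_inv; apply hu].
Qed.

Lemma conv_dense K D :
  (forall x, K x -> exists u, (forall n, D (u n)) /\ conv u x) -> dense_in K D.
Proof.
  intros h x hx e he. destruct (h x hx) as (u & hu & hc).
  destruct (conv_eps u x e hc he) as [N hN]. exists (u N); auto.
Qed.

(** The difference of [x] and [y] is a limit of vectors of [D], to all of which it is orthogonal,
    hence it is orthogonal to itself. Many identities between operator values are reduced to this
    test. *)
Lemma dense_eq K D x y :
  subspace K -> dense_in K D -> K x -> K y ->
  (forall z, D z -> hinner x z = hinner y z) -> x = y.
Proof.
  intros hK hD hx hy h. apply sub_eq0, hinner_def.
  destruct (dense_conv K D (hsub x y) hD) as (u & hu & hc); [apply subspace_sub; auto|].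
  rewrite <- (inner_zerol H hzero).
  apply (conv_inner (fun _ => hsub x y) u (fun _ => hzero) (fun _ => hzero)); auto using conv_const.
  intro n. rewrite inner_subl, h by auto. rewrite inner_zerol. C_ring.
Qed.

(** Choosing for each n a pair of the graph within 1/(n+1) in both coordinates gives the sequential
    form, to which limit arguments apply. *)
Lemma closureE (X : op H) x y :
  op_closure X x y <-> exists u v, (forall n, X (u n) (v n)) /\ conv u x /\ conv v y.
Proof.
  split.
  - intro h.
    assert (hs : forall n, exists p : H * H,
      X (fst p) (snd p) /\ hdist x (fst p) < / INR (S n) /\ hdist y (snd p) < / INR (S n)).
    { intro n. destruct (h _ (inv_INR_pos n)) as (a & b & hab). exists (a, b); exact hab. }
    set (w := fun n => proj1_sig (constructive_indefinite_description _ (hs n))).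
    assert (hw : forall n, X (fst (w n)) (snd (w n)) /\
      hdist x (fst (w n)) < / INR (S n) /\ hdist y (snd (w n)) < / INR (S n)).
    { intro n. unfold w. apply proj2_sig. }
    exists (fun n => fst (w n)), (fun n => snd (w n)).
    split; [apply hw | split; apply conv_of_inv; apply hw].
  - intros (u & v & h & hu & hv) e he.
    destruct (conv_eps _ _ e hu he) as [N hN], (conv_eps _ _ e hv he) as [N' hN'].
    exists (u (N + N')%nat), (v (N + N')%nat). split; [auto|split; [apply hN | apply hN']; lia].
Qed.

End HilbertNorm.

(** * Orthogonal projections and adjoints *)

Section Projection.
Variable H : HilbertSpace.
#[local] Arguments hsub {H}.
#[local] Arguments hnorm {H}.
#[local] Arguments hdist {H}.
#[local] Arguments subspace {H}.
#[local] Arguments closed_set {H}.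
#[local] Arguments boundedK {H}.
#[local] Arguments conv {H}.
Implicit Types (x y z : H) (u : nat -> H) (V K : H -> Prop).

Lemma conv_cauchy u :
  (forall eps, 0 < eps -> exists N, forall m n, (N <= m)%nat -> (N <= n)%nat ->
     hnorm (hsub (u m) (u n)) < eps) -> exists l, conv u l.
Proof.
  intro h. destruct (hcomplete H u h) as [l hl]. exists l. intros e he.
  destruct (hl e he) as [N hN]. exists N; intros n hn. specialize (hN n hn).
  unfold Rdist. rewrite Rminus_0_r, Rabs_pos_eq by apply norm_ge0.
  unfold hdist. rewrite norm_sub_sym. exact hN.
Qed.

(** First variation: a quadratic in [s] that vanishes at 0 and is nowhere negative has derivative
    zero there. *)
Lemma linear_quadratic (a b : R) : (forall s, 0 <= - 2 * s * a + s * s * b) -> a = 0.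
Proof.
  intro h. destruct (Req_dec b 0) as [->|hb].
  - pose proof (h 1); pose proof (h (-1)); lra.
  - pose proof (h 1); pose proof (h (-1)).
    (* The minimiser [s = a / b] gives the value -a²/b. *)
    assert (0 < b) by lra. pose proof (h (a / b)) as h1.
    replace (-2 * (a / b) * a + a / b * (a / b) * b) with (- (a * a) / b) in h1 by (field; lra).
    assert (0 <= - (a * a)).
    { replace (- (a * a)) with (- (a * a) / b * b) by (field; lra). apply Rmult_le_pos; lra. }
    nra.
Qed.

(** A minimising sequence for the distance from [x] to [V] is Cauchy by the parallelogram law; at
    its limit the first variation in each direction of [V] vanishes, which is orthogonality. *)
Lemma projection_exists V x :
  subspace V -> closed_set V ->
  exists p, V p /\ forall v, V v -> hinner (hsub x p) v = C0.
Proof.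
  intros hV hVc. destruct hV as (V0 & Va & Vs).
  set (sq := fun y => Cre (hinner y y)).
  (* [A] holds the negated squared distances, since completeness supplies suprema; the infimum of
     the squared distances is thus [- m]. *)
  set (A := fun r => exists v, V v /\ r = - sq (hsub x v)).
  destruct (completeness A) as [m [mub mlub]].
  { exists 0. intros r (v & _ & ->). pose proof (hinner_pos _ (hsub x v)). unfold sq; lra. }
  { exists (- sq (hsub x hzero)), hzero; auto. }
  assert (hmin : forall v, V v -> - m <= sq (hsub x v)).
  { intros v hv. assert (- sq (hsub x v) <= m); [|lra]. apply mub. exists v; auto. }
  assert (hs : forall n, exists v, V v /\ sq (hsub x v) < - m + / INR (S n)).
  { intro n. apply NNPP; intro hn. pose proof (inv_INR_pos n).
    assert (m <= m - / INR (S n)); [|lra].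
    apply mlub. intros r (v & hv & ->).
    destruct (Rlt_le_dec (sq (hsub x v)) (- m + / INR (S n))); [|lra].
    exfalso; apply hn; exists v; auto. }
  set (u := fun n => proj1_sig (constructive_indefinite_description _ (hs n))).
  assert (hu : forall n, V (u n) /\ sq (hsub x (u n)) < - m + / INR (S n)).
  { intro n. unfold u. apply proj2_sig. }
  destruct (conv_cauchy u) as [p hp].
  { intros e he.
    assert (he2 : 0 < e * e / 4) by nra.
    destruct (archimed_cor1 _ he2) as (N & hN & hN0). exists N. intros i j hi hj.
    assert (inv : forall k, (N <= k)%nat -> / INR (S k) <= / INR N).
    { intros k hk. apply Rinv_le_contravar; [apply lt_0_INR; lia | apply le_INR; lia]. }
    pose proof (inv i hi); pose proof (inv j hj).
    pose proof (proj2 (hu i)) as hi2; pose proof (proj2 (hu j)) as hj2.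
    (* The midpoint lies in [V], so its squared distance to [x] is at least [- m]; the parallelogram
       law then bounds the squared gap by 4/N, whence the choice of [e * e / 4]. *)
    pose proof (hmin (hscal (mkC (/2) 0) (hadd (u i) (u j)))
                  (Vs _ _ (Va _ _ (proj1 (hu i)) (proj1 (hu j))))) as hm.
    (* parallelogram law *)
    assert (hpar : sq (hsub (u i) (u j)) = 2 * sq (hsub x (u i)) + 2 * sq (hsub x (u j))
               - 4 * sq (hsub x (hscal (mkC (/2) 0) (hadd (u i) (u j))))).
    { unfold sq. repeat progress inner_expand. simpl.
      rewrite (hinner_conj _ x (u i)), (hinner_conj _ x (u j)), (hinner_conj _ (u i) (u j)).
      simpl. field. }
    assert (hlt : sq (hsub (u i) (u j)) < e * e) by lra.
    unfold sq in hlt. rewrite <- norm_sq in hlt.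
    pose proof (norm_ge0 _ (hsub (u i) (u j))). nra. }
  assert (Vp : V p) by (apply (closed_conv H V u); auto; apply hu).
  assert (hpm : sq (hsub x p) <= - m).
  { assert (hc : conv (fun n => hsub x (u n)) (hsub x p)).
    { intros e he. destruct (hp e he) as [N hN]. exists N; intros n hn.
      specialize (hN n hn). unfold hdist in *.
      replace (hsub (hsub x p) (hsub x (u n))) with (hsub (u n) p) by vec_ring.
      rewrite norm_sub_sym. exact hN. }
    pose proof (conv_re _ _ _ _ _ hc hc) as hr.
    apply Rnot_lt_le; intro hlt.
    set (e := (sq (hsub x p) + m) / 2). assert (he : 0 < e) by (unfold e; lra).
    destruct (hr e he) as [N1 h1], (archimed_cor1 e he) as (N2 & h2 & hN2).
    specialize (h1 (N1 + N2)%nat ltac:(lia)).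
    pose proof (proj2 (hu (N1 + N2)%nat)) as h3.
    assert (/ INR (S (N1 + N2)) <= / INR N2).
    { apply Rinv_le_contravar; [apply lt_0_INR; lia | apply le_INR; lia]. }
    unfold Rdist in h1. apply Rabs_def2 in h1 as [_ h1]. unfold e, sq in h1, h2, h3. lra. }
  assert (hre : forall v, V v -> Cre (hinner (hsub x p) v) = 0).
  { intros v hv. apply linear_quadratic with (b := sq v). intro s.
    pose proof (hmin (hadd p (hscal (mkC s 0) v)) (Va _ _ Vp (Vs _ _ hv))) as hm.
    assert (heq : sq (hsub x (hadd p (hscal (mkC s 0) v)))
       = sq (hsub x p) + (- 2 * s * Cre (hinner (hsub x p) v) + s * s * sq v)).
    { unfold sq. repeat progress inner_expand. simpl.
      rewrite (hinner_conj _ x p), (hinner_conj _ x v), (hinner_conj _ p v). simpl. ring. }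
    lra. }
  exists p; split; [exact Vp|]. intros v hv. apply C_ext; [auto|].
  rewrite inner_im. apply hre; auto.
Qed.

(** The projection is chosen pointwise. Its last property, uniqueness of the orthogonal
    decomposition, is the one used to compute [P], and idempotence is a case of it; linearity
    follows from symmetry. *)
Lemma orthogonal_projection V :
  subspace V -> closed_set V ->
  exists P : H -> H,
    boundedK (fun _ => True) P /\ (forall x, V (P x)) /\
    (forall x y, hinner (P x) y = hinner x (P y)) /\
    (forall x p, V p -> (forall v, V v -> hinner (hsub x p) v = C0) -> P x = p).
Proof.
  intros hV hVc. pose proof hV as (_ & Va & Vs).
  set (P := fun x => proj1_sig
    (constructive_indefinite_description _ (projection_exists V x hV hVc))).
  assert (hP : forall x, V (P x) /\ forall v, V v -> hinner (hsub x (P x)) v = C0).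
  { intro x. unfold P. apply proj2_sig. }
  assert (hu : forall x p, V p -> (forall v, V v -> hinner (hsub x p) v = C0) -> P x = p).
  { intros x p hp ho. destruct (hP x) as [hx hxo]. apply sub_eq0, hinner_def.
    set (w := hsub (P x) p). assert (hw : V w) by (apply subspace_sub; auto).
    unfold w at 1. replace (hsub (P x) p) with (hsub (hsub x p) (hsub x (P x))) by vec_ring.
    rewrite inner_subl, ho, hxo by auto. C_ring. }
  assert (hs : forall x y, hinner (P x) y = hinner x (P y)).
  { assert (hr : forall x y, hinner x (P y) = hinner (P x) (P y)).
    { intros x y. replace x with (hadd (hsub x (P x)) (P x)) at 1 by vec_ring.
      rewrite hinner_addl, (proj2 (hP x)) by apply hP. C_ring. }
    intros x y. rewrite hr, hinner_conj, hr, <- hinner_conj. reflexivity. }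
  exists P. repeat split; auto; [| |exists 1|apply hP].
  - intros x y _ _. apply inner_ext; intro z. rewrite hinner_addl, !hs, hinner_addl. reflexivity.
  - intros a x _. apply inner_ext; intro z. rewrite hinner_scall, !hs, hinner_scall. reflexivity.
  - intros x _. rewrite Rmult_1_l.
    pose proof (cauchy_schwarz _ x (P x)) as h.
    rewrite <- hs in h.
    assert (hPP : P (P x) = P x).
    { apply hu; [apply hP|]. intros v _. replace (hsub (P x) (P x)) with (hzero : H) by vec_ring.
      apply inner_zerol. }
    rewrite <- hPP, hs, hPP, <- norm_sq in h.
    pose proof (norm_ge0 _ x). pose proof (norm_ge0 _ (P x)).
    rewrite Rabs_pos_eq in h by nra.
    destruct (Req_dec (hnorm (P x)) 0); [lra|].
    apply (Rmult_le_reg_r (hnorm (P x))); lra.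
Qed.

(** Continuity of [f] enters as sequential closedness of its kernel within [K]. If [f] does not
    vanish on [K], the component [z'] of some [z] orthogonal to the kernel is nonzero, and [w] is
    [z'] scaled by conj(f z')/|z'|². *)
Lemma riesz K (f : H -> C) :
  subspace K -> closed_set K ->
  (forall x y, K x -> K y -> f (hadd x y) = Cadd (f x) (f y)) ->
  (forall a x, K x -> f (hscal a x) = Cmul a (f x)) ->
  (forall u x, (forall n, K (u n) /\ f (u n) = C0) -> K x -> conv u x -> f x = C0) ->
  exists w, K w /\ forall x, K x -> f x = hinner x w.
Proof.
  intros hK hKc fa fs fc. pose proof hK as (K0 & Ka & Ks).
  destruct (classic (forall z, K z -> f z = C0)) as [h0|h0].
  { exists hzero; split; auto. intros x hx. rewrite inner_zeror; auto. }
  apply not_all_ex_not in h0 as [z hz]. apply imply_to_and in hz as [hzK hz].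
  set (V := fun x => K x /\ f x = C0).
  assert (f0 : f hzero = C0).
  { replace (hzero : H) with (hscal C0 (hzero : H)) by vec_ring. rewrite fs by auto. C_ring. }
  destruct (projection_exists V z) as (p & [hp fp] & hort).
  { split; [split; auto|split].
    - intros x y [hx fx] [hy fy]. split; [auto|]. rewrite fa, fx, fy by auto. C_ring.
    - intros a x [hx fx]. split; [auto|]. rewrite fs, fx by auto. C_ring. }
  { apply closed_set_conv. intros u x hu hc.
    assert (K x) by (apply (closed_conv H K u); auto; apply hu).
    split; auto. apply (fc u); auto. }
  set (z' := hsub z p). assert (hz'K : K z') by (apply subspace_sub; auto).
  assert (fz' : f z' = f z).
  { unfold z', hsub. rewrite opp_scal, fa, fs, fp by auto. C_ring. }
  assert (hn : Cre (hinner z' z') <> 0).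
  { intro h. apply hz. rewrite <- fz'. replace z' with (hzero : H); [auto|].
    symmetry. apply hinner_def. apply C_ext; [exact h | apply inner_self_im]. }
  set (N := Cre (hinner z' z')) in *.
  exists (hscal (Cmul (mkC (/ N) 0) (Cconj (f z'))) z'). split; [auto|]. intros x hx.
  (* This combination lies in the kernel of [f], so it is orthogonal to [z'], and solving for [f x]
     gives the formula. *)
  assert (hv : V (hsub (hscal (f z') x) (hscal (f x) z'))).
  { split; [apply subspace_sub; auto|]. unfold hsub. rewrite opp_scal, fa, !fs by auto. C_ring. }
  apply hort in hv. fold z' in hv.
  rewrite inner_subr, !inner_scalr, (hinner_conj _ x z') in hv.
  assert (hN : hinner z' z' = mkC N 0) by (apply C_ext; [reflexivity | apply inner_self_im]).
  rewrite hN in hv. rewrite inner_scalr.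
  destruct (f z') as [a b], (f x) as [e g], (hinner x z') as [r s].
  injection hv; intros h2 h1. simpl in h1, h2.
  apply C_ext; simpl; apply (Rmult_eq_reg_l N); auto; field_simplify; auto; lra.
Qed.

Lemma adjoint_exists K (Cf : H -> H) :
  subspace K -> closed_set K -> boundedK K Cf ->
  exists Cs, boundedK K Cs /\ forall x y, K x -> K y -> hinner (Cf x) y = hinner x (Cs y).
Proof.
  intros hK hKc hC. pose proof hK as (K0 & Ka & Ks). pose proof hC as (Ck & Ca & Csc & c & hc).
  (* The witness is unconstrained for [y] outside [K], so that choice yields a function defined on
     all of [H]. *)
  assert (hr : forall y, exists w, K y -> K w /\ forall x, K x -> hinner (Cf x) y = hinner x w).
  { intro y. destruct (classic (K y)) as [hy|hy]; [|exists y; tauto].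
    destruct (riesz K (fun x => hinner (Cf x) y)) as [w hw]; auto.
    - intros; rewrite Ca by auto. apply hinner_addl.
    - intros; rewrite Csc by auto. apply hinner_scall.
    - intros u x hu hx hcv.
      rewrite <- (inner_zerol H y).
      apply (conv_inner H (fun n => Cf (u n)) (fun _ => y) (fun _ => hzero) (fun _ => y));
        auto using conv_const.
      + apply (bounded_conv H K); auto. apply hu.
      + intro n. rewrite inner_zerol. apply hu.
    - exists w; auto. }
  set (Cs := fun y => proj1_sig (constructive_indefinite_description _ (hr y))).
  assert (hs : forall y, K y -> K (Cs y) /\ forall x, K x -> hinner (Cf x) y = hinner x (Cs y)).
  { intros y. unfold Cs. apply (proj2_sig (constructive_indefinite_description _ (hr y))). }
  assert (ext : forall x y, K x -> K y -> (forall z, K z -> hinner z x = hinner z y) -> x = y).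
  { intros x y hx hy h. apply sub_eq0, hinner_def. rewrite inner_subr, h.
    - C_ring.
    - apply subspace_sub; auto. }
  exists Cs. split; [|intros x y hx hy; apply hs; auto].
  repeat split.
  - intros x hx; apply hs; auto.
  - intros x y hx hy. apply ext; [apply hs; auto | apply Ka; apply hs; auto |].
    intros z hz. rewrite inner_addr. rewrite <- !(fun y h => proj2 (hs y h) z hz) by auto.
    apply inner_addr.
  - intros a x hx. apply ext; [apply hs; auto | apply Ks; apply hs; auto |].
    intros z hz. rewrite inner_scalr. rewrite <- !(fun y h => proj2 (hs y h) z hz) by auto.
    apply inner_scalr.
  - exists c. intros y hy. destruct (hs y hy) as [hk hw].
    pose proof (norm_ge0 _ (Cs y)). pose proof (norm_ge0 _ y).
    destruct (Req_dec (hnorm (Cs y)) 0) as [h0|h0].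
    + pose proof (hc y hy). pose proof (norm_ge0 _ (Cf y)). lra.
    (* The square of |Cs y| equals <Cf (Cs y), y>, which is at most c |Cs y| |y|; cancelling |Cs y|
       leaves the same constant [c]. *)
    + pose proof (cauchy_schwarz _ (Cf (Cs y)) y) as h. rewrite hw in h by auto.
      rewrite <- norm_sq, Rabs_pos_eq in h by nra.
      pose proof (hc _ hk) as h1.
      assert (hnorm (Cf (Cs y)) * hnorm y <= c * hnorm (Cs y) * hnorm y)
        by (apply Rmult_le_compat_r; auto).
      apply (Rmult_le_reg_r (hnorm (Cs y))); nra.
Qed.
End Projection.

(** * The Hilbert sum of two copies of [H] and the matrix entries of its operators *)

Section Product.
Variable H : HilbertSpace.

Definition padd (p q : H * H) : H * H := (hadd (fst p) (fst q), hadd (snd p) (snd q)).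
Definition popp (p : H * H) : H * H := (hopp (fst p), hopp (snd p)).
Definition pscal (a : C) (p : H * H) : H * H := (hscal a (fst p), hscal a (snd p)).
Definition pinner (p q : H * H) : C := Cadd (hinner (fst p) (fst q)) (hinner (snd p) (snd q)).

Lemma pair_ext (p q : H * H) : fst p = fst q -> snd p = snd q -> p = q.
Proof. destruct p, q; simpl; intros -> ->; reflexivity. Qed.

Lemma pinner_def (p : H * H) : pinner p p = C0 -> p = (hzero, hzero).
Proof.
  intro h. pose proof (f_equal Cre h) as hr. simpl in hr.
  pose proof (hinner_pos _ (fst p)); pose proof (hinner_pos _ (snd p)).
  apply pair_ext; simpl; apply hinner_def; apply C_ext; try apply inner_self_im; simpl; lra.
Qed.

Lemma pcomplete (u : nat -> H * H) :
  (forall eps, 0 < eps -> exists N, forall m n, (N <= m)%nat -> (N <= n)%nat ->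
     sqrt (Cre (pinner (padd (u m) (popp (u n))) (padd (u m) (popp (u n))))) < eps) ->
  exists l, forall eps, 0 < eps -> exists N, forall n, (N <= n)%nat ->
     sqrt (Cre (pinner (padd (u n) (popp l)) (padd (u n) (popp l)))) < eps.
Proof.
  intro h.
  destruct (hcomplete H (fun n => fst (u n))) as [a ha].
  { intros e he. destruct (h e he) as [N hN]. exists N; intros m n hm hn.
    eapply Rle_lt_trans; [|apply (hN m n hm hn)]. apply sqrt_le_1_alt.
    unfold pinner; simpl.
    pose proof (hinner_pos _ (hadd (snd (u m)) (hopp (snd (u n))))). lra. }
  destruct (hcomplete H (fun n => snd (u n))) as [b hb].
  { intros e he. destruct (h e he) as [N hN]. exists N; intros m n hm hn.
    eapply Rle_lt_trans; [|apply (hN m n hm hn)]. apply sqrt_le_1_alt.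
    unfold pinner; simpl.
    pose proof (hinner_pos _ (hadd (fst (u m)) (hopp (fst (u n))))). lra. }
  exists (a, b). intros e he. assert (he2 : 0 < e / 2) by lra.
  destruct (ha _ he2) as [N hN], (hb _ he2) as [N' hN'].
  exists (N + N')%nat. intros n hn.
  specialize (hN n ltac:(lia)). specialize (hN' n ltac:(lia)).
  unfold pinner; simpl.
  pose proof (hinner_pos _ (hadd (fst (u n)) (hopp a))) as pa.
  pose proof (hinner_pos _ (hadd (snd (u n)) (hopp b))) as pb.
  rewrite <- (sqrt_square e) by lra. apply sqrt_lt_1_alt. split; [simpl; lra|].
  pose proof (sqrt_sqrt _ pa) as sa. pose proof (sqrt_sqrt _ pb) as sb.
  pose proof (sqrt_pos (Cre (hinner (hadd (fst (u n)) (hopp a)) (hadd (fst (u n)) (hopp a))))).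
  pose proof (sqrt_pos (Cre (hinner (hadd (snd (u n)) (hopp b)) (hadd (snd (u n)) (hopp b))))).
  simpl. nra.
Qed.

(** A closed operator is a closed subspace of this Hilbert sum. The definition is transparent, so
    that its operations reduce to those on coordinates. *)
Definition prodH : HilbertSpace.
Proof.
  refine {| hcar := (H * H)%type; hzero := (hzero, hzero); hadd := padd; hopp := popp;
            hscal := pscal; hinner := pinner; hinner_def := pinner_def; hcomplete := pcomplete |};
    intros; try (apply pair_ext; simpl; vec_ring).
  - unfold pinner, padd; simpl. rewrite !hinner_addl. C_ring.
  - unfold pinner, pscal; simpl. rewrite !hinner_scall. C_ring.
  - unfold pinner. rewrite (hinner_conj _ (fst x)), (hinner_conj _ (snd x)). C_ring.
  - simpl. pose proof (hinner_pos _ (fst x)). pose proof (hinner_pos _ (snd x)). lra.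
Defined.

Lemma conv_pair (u : nat -> prodH) (p : prodH) :
  conv prodH u p <-> conv H (fun n => fst (u n)) (fst p) /\ conv H (fun n => snd (u n)) (snd p).
Proof.
  assert (hd : forall q r : prodH, hdist prodH q r * hdist prodH q r
     = hdist H (fst q) (fst r) * hdist H (fst q) (fst r)
       + hdist H (snd q) (snd r) * hdist H (snd q) (snd r)).
  { intros q r. unfold hdist. rewrite !norm_sq. reflexivity. }
  assert (ge : forall (G : HilbertSpace) (x y : G), 0 <= hdist G x y) by (intros; apply dist_ge0).
  split.
  - intro h. split; apply (Un_cv0_le _ _) with (2 := h); intro n;
      pose proof (hd p (u n)); pose proof (ge _ p (u n));
      pose proof (ge H (fst p) (fst (u n))); pose proof (ge H (snd p) (snd (u n)));
      split; auto; nra.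
  - intros [h1 h2].
    apply (Un_cv0_le _ (fun n => hdist H (fst p) (fst (u n)) + hdist H (snd p) (snd (u n)))).
    + intro n. pose proof (hd p (u n)); pose proof (ge _ p (u n));
      pose proof (ge H (fst p) (fst (u n))); pose proof (ge H (snd p) (snd (u n))).
      split; auto; nra.
    + rewrite <- (Rplus_0_r 0). apply (CV_plus _ _ _ _ h1 h2).
Qed.

(* The two copies of [H] in [prodH] are indexed by [bool], [true] being the first. *)
Definition pin (a : bool) (x : H) : prodH := if a then (x, hzero) else (hzero, x).
Definition pout (a : bool) (p : prodH) : H := if a then fst p else snd p.

Lemma pin_pout p : hadd (pin true (fst p)) (pin false (snd p)) = p.
Proof.
  destruct p as [x y]. apply pair_ext; simpl; [apply hadd_0|]. rewrite hadd_comm. apply hadd_0.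
Qed.

Lemma pout_add a (p q : prodH) : pout a (hadd p q) = hadd (pout a p) (pout a q).
Proof. destruct a; reflexivity. Qed.

Lemma inner_pin a (p : prodH) (x : H) : hinner p (pin a x) = hinner (pout a p) x.
Proof.
  destruct a; simpl; unfold pinner; simpl; rewrite inner_zeror; C_ring.
Qed.

(** For symmetric [P] the adjoint of a matrix entry is the transposed entry. *)
Lemma compression_sym (P : prodH -> prodH) a b x y :
  (forall p q, hinner (P p) q = hinner p (P q)) ->
  hinner (pout b (P (pin a x))) y = hinner x (pout a (P (pin b y))).
Proof.
  intro hP. rewrite <- inner_pin, hP, (hinner_conj _ _ x), <- inner_pin, <- hinner_conj.
  reflexivity.
Qed.

(** [pin] is isometric and [pout] does not increase norms, so a bound for [P] bounds every entry. *)
Lemma compression_bounded (P : prodH -> prodH) a b :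
  boundedK prodH (fun _ => True) P -> boundedK H (fun _ => True) (fun x => pout b (P (pin a x))).
Proof.
  intros (_ & Pa & Ps & c & hc). split; [auto|]. split; [|split; [|exists c]].
  - intros x y _ _. rewrite <- pout_add, <- Pa by auto. f_equal. f_equal.
    destruct a; apply pair_ext; simpl; try reflexivity; symmetry; apply hadd_0.
  - intros k x _.
    replace (pin a (hscal k x)) with (hscal k (pin a x)).
    + rewrite Ps by auto. destruct b; reflexivity.
    + destruct a; apply pair_ext; simpl; try reflexivity; vec_ring.
  - intros x _. apply Rle_trans with (hnorm prodH (P (pin a x))).
    + apply norm_le_sq; [apply norm_ge0|]. rewrite norm_sq.
      destruct (P (pin a x)) as [y z]. simpl.
      pose proof (hinner_pos _ y). pose proof (hinner_pos _ z). destruct b; simpl; lra.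
    + replace (hnorm H x) with (hnorm prodH (pin a x)); [apply hc; auto|].
      unfold hnorm. f_equal. rewrite inner_pin. destruct a; reflexivity.
Qed.
End Product.

(** * Full closures and weak products *)

Section Operators.
Variable H : HilbertSpace.
#[local] Arguments closed_set {H}.
#[local] Arguments boundedK {H}.
#[local] Arguments op_closure {H}.
#[local] Arguments opdom {H}.
#[local] Arguments op_eq {H}.
#[local] Arguments inS {H}.
#[local] Arguments linop {H}.
#[local] Arguments adjK {H}.
#[local] Arguments restr {H}.
#[local] Arguments dag {H}.
#[local] Arguments Ldag {H}.
#[local] Arguments setting {H}.
#[local] Arguments Ostar_vs {H}.
#[local] Arguments wmul {H}.
#[local] Arguments wmul_defined {H}.
#[local] Arguments partial_Oalg {H}.
#[local] Arguments Dhat {H}.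
#[local] Arguments full_closure {H}.
#[local] Arguments fully_closed {H}.
#[local] Arguments weak_commutant {H}.
#[local] Arguments bicommutant {H}.
Implicit Types (x y z : H) (K D : H -> Prop) (X Y : op H) (M : op H -> Prop).

Lemma inner_sym_eq x y x' y' : hinner x y = hinner x' y' -> hinner y x = hinner y' x'.
Proof. intro h. rewrite hinner_conj, h, <- hinner_conj. reflexivity. Qed.

Lemma closure_incl X x y : X x y -> op_closure X x y.
Proof.
  intro h. apply closureE. exists (fun _ => x), (fun _ => y). auto using conv_const.
Qed.

Lemma closure_mono X Y : (forall x y, X x y -> Y x y) ->
  forall x y, op_closure X x y -> op_closure Y x y.
Proof.
  intros h x y hx e he. destruct (hx e he) as (a & b & hab & hd). exists a, b; auto.
Qed.

Lemma closure_idem X Y : (forall x y, X x y -> op_closure Y x y) ->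
  forall x y, op_closure X x y -> op_closure Y x y.
Proof.
  intros h x y hx e he. assert (he2 : 0 < e / 2) by lra.
  destruct (hx _ he2) as (a & b & hab & ha & hb).
  destruct (h _ _ hab _ he2) as (a' & b' & hab' & ha' & hb').
  exists a', b'. split; [auto|].
  pose proof (dist_triangle H x a a'). pose proof (dist_triangle H y b b'). lra.
Qed.

Lemma closure_add X x y x' y' : linop X ->
  op_closure X x y -> op_closure X x' y' -> op_closure X (hadd x x') (hadd y y').
Proof.
  intros (_ & _ & ha & _) h h'. apply closureE in h as (u & v & hX & hu & hv).
  apply closureE in h' as (u' & v' & hX' & hu' & hv'). apply closureE.
  exists (fun n => hadd (u n) (u' n)), (fun n => hadd (v n) (v' n)). auto using conv_add.
Qed.

Lemma closure_scal X a x y : linop X -> op_closure X x y -> op_closure X (hscal a x) (hscal a y).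
Proof.
  intros (_ & _ & _ & hs) h. apply closureE in h as (u & v & hX & hu & hv). apply closureE.
  exists (fun n => hscal a (u n)), (fun n => hscal a (v n)). auto using conv_scal.
Qed.

(** Continuity of the inner product extends a formal adjoint relation from two graphs to their
    closures. *)
Lemma closure_pair X Y :
  (forall x y e z, X x y -> Y e z -> hinner y e = hinner x z) ->
  forall x y e z, op_closure X x y -> op_closure Y e z -> hinner y e = hinner x z.
Proof.
  intros h x y e z hx he.
  apply closureE in hx as (u & v & hX & hu & hv).
  apply closureE in he as (u' & v' & hY & hu' & hv').
  apply (conv_inner H v u' u v'); auto.
Qed.

Lemma closure_adj K X x y e z : op_closure X x y -> adjK K X e z -> hinner y e = hinner x z.
Proof.
  (* The single point [(e, z)] serves as the second graph. *)
  intros hx he. apply (closure_pair X (fun a b => a = e /\ b = z)).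
  - intros a b a' b' h (-> & ->). apply he; auto.
  - exact hx.
  - apply closure_incl; auto.
Qed.

Lemma closure_subset K X : closed_set K -> (forall x y, X x y -> K x /\ K y) ->
  forall x y, op_closure X x y -> K x /\ K y.
Proof.
  intros hK h x y hx. apply closureE in hx as (u & v & hX & hu & hv).
  split; [apply (closed_conv H K u) | apply (closed_conv H K v)]; auto; intro n; apply (h _ _ (hX n)).
Qed.

Lemma adj_ext K X Y : op_eq X Y -> forall e z, adjK K X e z -> adjK K Y e z.
Proof. intros h e z (h1 & h2 & h3). repeat split; auto. intros; apply h3, h; auto. Qed.

Lemma dag_ext K D X Y : op_eq X Y -> forall e z, dag K D X e z -> dag K D Y e z.
Proof. intros h e z (h1 & h2). split; eauto using adj_ext. Qed.

Lemma op_eq_sym X Y : op_eq X Y -> op_eq Y X.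
Proof. intros h x y; split; apply h. Qed.

Lemma Ldag_ext K D X Y : op_eq X Y -> Ldag K D X -> Ldag K D Y.
Proof.
  intros h (h1 & (l1 & l2 & l3 & l4) & h3 & h4).
  split; [|split; [|split]].
  - intro x. split.
    + intros (y & hy). apply h1. exists y. apply h; auto.
    + intro hx. apply h1 in hx as [y hy]. exists y; apply h; auto.
  - split; [|split; [|split]].
    + intros x y y' a b. apply (l1 x); apply h; auto.
    + apply h; auto.
    + intros x y x' y' a b. apply h. apply l3; apply h; auto.
    + intros a x y b. apply h. apply l4; apply h; auto.
  - intros x y a. apply (h3 x); apply h; auto.
  - intros e he. destruct (h4 e he) as [z hz]. exists z. eapply adj_ext; eauto.
Qed.

Lemma Ldag_dom K D X x y : Ldag K D X -> X x y -> D x.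
Proof. intros (h & _) hx. apply h. exists y; auto. Qed.

Lemma Ldag_val K D X x : Ldag K D X -> D x -> exists y, X x y.
Proof. intros (h & _) hx. apply h in hx. exact hx. Qed.

Lemma Ldag_dag K D X x : Ldag K D X -> D x -> exists y, dag K D X x y.
Proof. intros (_ & _ & _ & h) hx. destruct (h x hx) as [y hy]. exists y; split; auto. Qed.

Lemma Ldag_closure_K K D X x y : setting K D -> Ldag K D X -> op_closure X x y -> K x /\ K y.
Proof.
  intros (_ & hKc & _ & hDK & _) hX. apply closure_subset; auto.
  intros a b hab. split; [apply hDK, (Ldag_dom _ _ _ _ _ hX hab) | apply hX in hab; exact hab].
Qed.

(** Closability: [X] has an adjoint on the dense [D], so two values of its closure at [x] have the
    same inner products with [D]. *)
Lemma Ldag_closure_fun K D X x y y' : setting K D -> Ldag K D X ->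
  op_closure X x y -> op_closure X x y' -> y = y'.
Proof.
  intros hs hX h h'. pose proof hs as (hK & _ & _ & _ & hd).
  destruct (Ldag_closure_K K D X x y), (Ldag_closure_K K D X x y'); auto.
  apply (dense_eq H K D); auto.
  intros e he. destruct (Ldag_dag _ _ _ _ hX he) as (z & _ & hz).
  rewrite (closure_adj K X x y e z), (closure_adj K X x y' e z); auto.
Qed.

Lemma adj_fun K D X e z z' : setting K D -> (forall x, D x -> opdom X x) ->
  adjK K X e z -> adjK K X e z' -> z = z'.
Proof.
  intros (hK & _ & _ & _ & hd) hX (_ & hz & h) (_ & hz' & h').
  apply (dense_eq H K D); auto. intros x hx. apply inner_sym_eq.
  destruct (hX x hx) as [y hy]. rewrite <- (h _ _ hy). apply h'; auto.
Qed.

(** * The full closure of an O*-vector space and its weak commutant *)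

Section FullClosure.
Variables (K D : H -> Prop) (M : op H -> Prop).
Hypothesis hM : Ostar_vs K D M.

Let hset : setting K D. Proof. apply hM. Qed.
Let hL X : M X -> Ldag K D X. Proof. apply hM. Qed.

Lemma Dhat_incl x : D x -> Dhat M x.
Proof.
  intros hx X hX. destruct (Ldag_val _ _ _ _ (hL X hX) hx) as [y hy].
  exists y. apply closure_incl; auto.
Qed.

Lemma Dhat_setting : setting K (Dhat M).
Proof.
  pose proof hset as (hK & hKc & (D0 & Da & Ds) & hDK & hd).
  split; [auto|]. split; [auto|]. split; [|split].
  - split; [|split].
    + apply Dhat_incl; auto.
    + intros x y hx hy X hX. destruct (hx X hX) as [a ha], (hy X hX) as [b hb].
      exists (hadd a b). apply closure_add; auto. apply hL; auto.
    + intros a x hx X hX. destruct (hx X hX) as [b hb]. exists (hscal a b).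
      apply closure_scal; auto. apply hL; auto.
  (* [M] is inhabited because it contains the zero operator, and the closure of a member has its
     domain in [K]. *)
  - intros x hx. destruct hM as (_ & _ & (X & hX & _) & _).
    destruct (hx X hX) as [y hy]. apply (Ldag_closure_K K D X x y); auto.
  - intros x hx e he. destruct (hd x hx e he) as (y & hy & hxy).
    exists y; split; auto. apply Dhat_incl; auto.
Qed.

Lemma closure_dag_adj X e z : M X -> op_closure (dag K D X) e z -> adjK K (op_closure X) e z.
Proof.
  intros hX he. pose proof hset as (_ & hKc & _ & hDK & _).
  destruct (closure_subset K (dag K D X) hKc) with (x := e) (y := z) as [h1 h2]; auto.
  { intros x y (_ & hk & hk' & _). auto. }
  split; [auto|]. split; [auto|]. intros x y hx.
  apply (closure_pair X (dag K D X)); auto.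
  intros a b a' b' ha (_ & _ & _ & hb). auto.
Qed.

(** [M] contains the dagger of [X], so its closure is among those whose domains are intersected in
    [Dhat M]. *)
Lemma Dhat_dag X e : M X -> Dhat M e -> exists z, op_closure (dag K D X) e z.
Proof.
  intros hX he. destruct hM as (_ & _ & _ & _ & _ & hd).
  destruct (hd X hX) as (X' & hX' & heq). destruct (he X' hX') as [z hz].
  exists z. revert hz. apply closure_mono. intros; apply heq; auto.
Qed.

(** The closure of the dagger is contained in the adjoint; since it has a value at every point of
    [Dhat M] and the adjoint is single-valued, the two agree there. *)
Lemma full_closure_dag X e z : M X -> Dhat M e ->
  dag K (Dhat M) (restr (op_closure X) (Dhat M)) e z <-> op_closure (dag K D X) e z.
Proof.
  intros hX he.
  assert (hback : forall z, op_closure (dag K D X) e z ->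
            adjK K (restr (op_closure X) (Dhat M)) e z).
  { intros z' hz. destruct (closure_dag_adj X e z' hX hz) as (h1 & h2 & h3).
    split; [auto|split; auto]. intros x y (_ & hx). auto. }
  split.
  - intros (_ & hz). destruct (Dhat_dag X e hX he) as [z' hz'].
    replace z with z'; auto.
    apply (adj_fun K (Dhat M) (restr (op_closure X) (Dhat M)) e); auto using Dhat_setting.
    intros x hx. destruct (hx X hX) as [y hy]. exists y; split; auto.
  - intro hz. split; auto.
Qed.

Lemma full_closure_Ldag X : M X -> Ldag K (Dhat M) (restr (op_closure X) (Dhat M)).
Proof.
  intro hX. pose proof Dhat_setting as (_ & _ & (D0 & Da & Ds) & _).
  pose proof (hL X hX) as hl. assert (hlin : linop X) by apply hl.
  split; [|split; [|split]].
  - intro x; split; [intros (y & hx & _); auto|].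
    intro hx. destruct (hx X hX) as [y hy]. exists y; split; auto.
  - split; [|split; [|split]].
    + intros x y y' (_ & h) (_ & h'). eapply Ldag_closure_fun; eauto.
    + split; auto. apply closure_incl. apply hlin.
    + intros x y x' y' (h1 & h2) (h1' & h2'). split; auto. apply closure_add; auto.
    + intros a x y (h1 & h2). split; auto. apply closure_scal; auto.
  - intros x y (_ & h). apply (Ldag_closure_K K D X x y); auto.
  - intros e he. destruct (Dhat_dag X e hX he) as [z hz].
    apply (full_closure_dag X e z hX he) in hz as (_ & hz). exists z; auto.
Qed.

Lemma full_closure_mem X : M X -> full_closure M (restr (op_closure X) (Dhat M)).
Proof. intro hX. exists X; split; auto. intros x y; tauto. Qed.

(** A sum or multiple in [M] is a member [S] whose closure has to agree on [Dhat M] with the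
    operation applied to the closures. All these closures have values there, and pairing with [D]
    through the adjoints identifies them. *)
Lemma full_closure_Ostar : Ostar_vs K (Dhat M) (full_closure M).
Proof.
  pose proof Dhat_setting as hds. pose proof hset as (hK & _ & hD & hDK & hdense).
  destruct hM as (_ & _ & (Z & hZ & hZ0) & hadd' & hscal' & hdag).
  split; [auto|]. split; [|split; [|split; [|split]]].
  - intros Y (X & hX & heq). apply (Ldag_ext _ _ _ _ (op_eq_sym _ _ heq)).
    apply full_closure_Ldag; auto.
  - exists (restr (op_closure Z) (Dhat M)). split; [apply full_closure_mem; auto|].
    assert (h0 : forall x z, op_closure Z x z -> z = hzero).
    { intros x z h. apply closureE in h as (u & v & huv & hu & hv).
      apply (conv_unique H v); auto.
      intros e he. destruct (conv_const H hzero e he) as [N hN].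
      exists N; intros n hn.
      destruct (proj1 (hZ0 _ _) (huv n)) as [_ ->]. apply (hN n hn). }
    intros x z; split.
    + intros (hx & hz). split; eauto.
    + intros (hx & ->). split; auto. destruct (hx Z hZ) as [y hy].
      rewrite <- (h0 x y hy). exact hy.
  - intros X' Y' (X & hX & heqX) (Y & hY & heqY).
    destruct (hadd' X Y hX hY) as (S & hS & heqS).
    exists (restr (op_closure S) (Dhat M)). split; [apply full_closure_mem; auto|].
    assert (key : forall x a b c, op_closure X x a -> op_closure Y x b -> op_closure S x c ->
              c = hadd a b).
    { intros x a b c ha hb hc.
      pose proof (Ldag_closure_K _ _ _ _ _ hset (hL X hX) ha).
      pose proof (Ldag_closure_K _ _ _ _ _ hset (hL Y hY) hb).
      pose proof (Ldag_closure_K _ _ _ _ _ hset (hL S hS) hc).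
      apply (dense_eq H K D); auto; try tauto.
      { destruct hK as (_ & Ka & _). apply Ka; tauto. }
      intros e he.
      destruct (Ldag_dag _ _ _ _ (hL X hX) he) as (z1 & _ & hz1).
      destruct (Ldag_dag _ _ _ _ (hL Y hY) he) as (z2 & _ & hz2).
      rewrite (closure_adj K S x c e (hadd z1 z2) hc).
      - rewrite hinner_addl, inner_addr, (closure_adj K X x a e z1), (closure_adj K Y x b e z2); auto.
      - destruct hz1 as (k1 & k2 & k3), hz2 as (l1 & l2 & l3).
        split; [auto|]. split; [apply hK; auto|]. intros xi y hy.
        apply heqS in hy as (y1 & y2 & h1 & h2 & ->).
        rewrite hinner_addl, inner_addr, (k3 _ _ h1), (l3 _ _ h2); auto. }
    intros x c; split.
    + intros (hx & hc). destruct (hx X hX) as [a ha], (hx Y hY) as [b hb].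
      exists a, b. split; [apply heqX; split; auto|]. split; [apply heqY; split; auto|]. eauto.
    + intros (a & b & ha & hb & ->). apply heqX in ha as (hx & ha). apply heqY in hb as (_ & hb).
      split; auto. destruct (hx S hS) as [c hc]. rewrite <- (key x a b c); auto.
  - intros k X' (X & hX & heqX).
    destruct (hscal' k X hX) as (S & hS & heqS).
    exists (restr (op_closure S) (Dhat M)). split; [apply full_closure_mem; auto|].
    assert (key : forall x a c, op_closure X x a -> op_closure S x c -> c = hscal k a).
    { intros x a c ha hc.
      pose proof (Ldag_closure_K _ _ _ _ _ hset (hL X hX) ha).
      pose proof (Ldag_closure_K _ _ _ _ _ hset (hL S hS) hc).
      apply (dense_eq H K D); auto; try tauto.
      { destruct hK as (_ & _ & Ks). apply Ks; tauto. }
      intros e he.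
      destruct (Ldag_dag _ _ _ _ (hL X hX) he) as (z1 & _ & hz1).
      rewrite (closure_adj K S x c e (hscal (Cconj k) z1) hc).
      - rewrite hinner_scall, inner_scalr, (closure_adj K X x a e z1); auto. C_ring.
      - destruct hz1 as (k1 & k2 & k3).
        split; [auto|]. split; [apply hK; auto|]. intros xi y hy.
        apply heqS in hy as (y1 & h1 & ->).
        rewrite hinner_scall, inner_scalr, (k3 _ _ h1); auto. C_ring. }
    intros x c; split.
    + intros (hx & hc). destruct (hx X hX) as [a ha].
      exists a. split; [apply heqX; split; auto|]. eauto.
    + intros (a & ha & ->). apply heqX in ha as (hx & ha).
      split; auto. destruct (hx S hS) as [c hc]. rewrite <- (key x a c); auto.
  - intros X' (X & hX & heqX).
    destruct (hdag X hX) as (S & hS & heqS).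
    exists (restr (op_closure S) (Dhat M)). split; [apply full_closure_mem; auto|].
    intros e z; split.
    + intros (he & hz).
      apply (dag_ext _ _ _ _ (op_eq_sym _ _ heqX)). apply full_closure_dag; auto.
      revert hz. apply closure_mono. intros; apply heqS; auto.
    + intro hz. pose proof hz as (he & _). split; auto.
      apply (dag_ext _ _ _ _ heqX) in hz. apply full_closure_dag in hz; auto.
      revert hz. apply closure_mono. intros; apply heqS; auto.
Qed.

(** A closure taken after restriction to [Dhat M] is still contained in the original closure, so no
    new vectors enter the domain. *)
Lemma full_closure_fully_closed : fully_closed (Dhat M) (full_closure M).
Proof.
  intro x; split.
  - intros hx X hX. destruct (hx _ (full_closure_mem X hX)) as [y hy]. exists y.
    revert hy. apply closure_idem. intros a b (_ & h); auto.
  - intros hx Y (X & hX & heq). destruct (hx X hX) as [y hy]. exists y.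
    apply closure_incl, heq. split; auto.
Qed.

(** A bounded operator respects limits, so its relation on [D] extends to the closures; conversely,
    the members of the full closure extend those of [M]. *)
Lemma full_closure_commutant Cf :
  weak_commutant K (Dhat M) (full_closure M) Cf <-> weak_commutant K D M Cf.
Proof.
  pose proof hset as (hK & hKc & _ & hDK & _).
  split; intros (hb & hc); (split; [auto|]).
  - intros X xi e y z hX hxi he hy hz.
    apply (hc _ xi e y z (full_closure_mem X hX)); auto using Dhat_incl.
    + split; auto using Dhat_incl, closure_incl.
    + apply full_closure_dag; auto using Dhat_incl, closure_incl.
  - intros Y xi e y z (X & hX & heq) hxi he hy hz.
    apply heq in hy as (_ & hy). apply (dag_ext _ _ _ _ heq) in hz.
    apply full_closure_dag in hz; auto.
    pose proof (Ldag_closure_K _ _ _ _ _ hset (hL X hX) hy) as [hk1 hk2].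
    apply closureE in hy as (u & v & huv & hu & hv).
    apply closureE in hz as (u' & v' & huv' & hu' & hv').
    assert (hDu : forall n, D (u n)) by (intro n; eapply Ldag_dom; eauto).
    apply (conv_inner H (fun n => Cf (v n)) u' (fun n => Cf (u n)) v'); auto.
    + apply (bounded_conv H K); auto. intro n.
      destruct (hL X hX) as (_ & _ & hv1 & _). eauto.
    + apply (bounded_conv H K); auto.
    + intro n. apply (hc X); auto. apply huv'.
Qed.
End FullClosure.

(** * Weak products and a weak commutant that preserves the domain *)

Section WeakProduct.
Variables (K D : H -> Prop) (M : op H -> Prop).
Hypothesis hM : Ostar_vs K D M.

Let hset : setting K D. Proof. apply hM. Qed.
Let hL X : M X -> Ldag K D X. Proof. apply hM. Qed.

Lemma dag_dag X x y : M X -> X x y -> dag K D (dag K D X) x y.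
Proof.
  intros hX hx. pose proof hset as (_ & _ & _ & hDK & _).
  pose proof (Ldag_dom _ _ _ _ _ (hL X hX) hx) as hd.
  split; [auto|]. split; [auto|]. split; [apply (hL X hX) in hx; auto|].
  intros e z (_ & _ & _ & h). apply inner_sym_eq. symmetry. auto.
Qed.

(** Exchanging the arguments of the inner product turns the relation for [Cf] and the dagger of [X],
    again a member of [M], into the relation for [Cs] and [X]. *)
Lemma commutant_adjoint Cf Cs :
  weak_commutant K D M Cf -> boundedK K Cs ->
  (forall x y, K x -> K y -> hinner (Cf x) y = hinner x (Cs y)) ->
  weak_commutant K D M Cs.
Proof.
  intros (hb & hc) hbs hadj. pose proof hset as (_ & _ & _ & hDK & _).
  split; auto. intros X xi e y z hX hxi he hy hz.
  destruct hM as (_ & _ & _ & _ & _ & hdag). destruct (hdag X hX) as (X' & hX' & heq).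
  pose proof hz as (_ & _ & hzK & _).
  assert (K y) by (apply (hL X hX) in hy; auto).
  apply inner_sym_eq. rewrite <- !hadj by auto.
  symmetry. apply (hc X'); auto; [apply heq; auto|].
  apply (dag_ext _ _ _ _ (op_eq_sym _ _ heq)). apply dag_dag; auto.
Qed.

Hypothesis hinv : forall Cf xi, weak_commutant K D M Cf -> D xi -> D (Cf xi).

(** Once [Cf] preserves [D], weak commutation becomes genuine: [X] is defined at [Cf x], and its
    value there has the same inner products with [D] as [Cf y]. *)
Lemma commutant_apply Cf X x y : weak_commutant K D M Cf -> M X -> X x y -> X (Cf x) (Cf y).
Proof.
  intros hC hX hx. pose proof hset as (hK & _ & _ & hDK & hd).
  pose proof (Ldag_dom _ _ _ _ _ (hL X hX) hx) as hxD.
  destruct (Ldag_val _ _ _ _ (hL X hX) (hinv _ _ hC hxD)) as [y' hy'].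
  replace (Cf y) with y'; auto.
  apply (dense_eq H K D); auto.
  - apply (hL X hX) in hy'; auto.
  - apply hC. apply (hL X hX) in hx; auto.
  - intros e he. destruct (Ldag_dag _ _ _ _ (hL X hX) he) as [z hz].
    destruct hC as (_ & hC). rewrite (hC X x e y z); auto. apply hz; auto.
Qed.

(** The first half of [wmul_defined] puts all of [D] in the domain of the product; the second half
    makes the adjoint of [X2], applied after the dagger of [X1], an adjoint of the product on
    [D]. *)
Lemma wmul_Ldag X1 X2 : M X1 -> M X2 -> wmul_defined K D X1 X2 -> Ldag K D (wmul K D X1 X2).
Proof.
  intros h1 h2 (hd1 & hd2). pose proof hset as (hK & _ & _ & hDK & hd).
  assert (hlin : linop X2) by (apply hL; auto). destruct hlin as (l1 & l2 & l3 & l4).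
  split; [|split; [|split]].
  - intro x; split.
    + intros (v & y & hy & _). eapply Ldag_dom; eauto.
    + intro hx. destruct (Ldag_val _ _ _ _ (hL X2 h2) hx) as [y hy].
      destruct (hd1 _ _ hy) as [v hv]. exists v, y; auto.
  - split; [|split; [|split]].
    + intros x v v' (y & hy & hv) (y' & hy' & hv'). rewrite (l1 _ _ _ hy' hy) in hv'.
      eapply (adj_fun K D); eauto. intros e he. destruct (Ldag_dag _ _ _ _ (hL X1 h1) he) as [z hz].
      exists z; auto.
    + exists hzero. split; auto. split; [apply hK|]. split; [apply hK|].
      intros; rewrite !inner_zeror; auto.
    + intros x v x' v' (y & hy & a1 & a2 & a3) (y' & hy' & b1 & b2 & b3).
      exists (hadd y y'). split; auto. split; [apply hK; auto|]. split; [apply hK; auto|].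
      intros e z hz. rewrite !inner_addr, (a3 _ _ hz), (b3 _ _ hz); auto.
    + intros a x v (y & hy & a1 & a2 & a3).
      exists (hscal a y). split; auto. split; [apply hK; auto|]. split; [apply hK; auto|].
      intros e z hz. rewrite !inner_scalr, (a3 _ _ hz); auto.
  - intros x v (y & _ & _ & hv & _); auto.
  - intros e he. destruct (Ldag_dag _ _ _ _ (hL X1 h1) he) as [z hz].
    destruct (hd2 _ _ hz) as [w (k1 & k2 & k3)]. exists w. split; [auto|]. split; [auto|].
    intros x v (y & hy & a1 & a2 & a3). rewrite <- (k3 _ _ hy). apply inner_sym_eq.
    symmetry. apply a3; auto.
Qed.

(** With W the weak product, X1' the dagger of [X1] and [w] the adjoint of [X2] applied to X1' e:
    <Cf W x, e> = <X2 x, X1' Cs e> = <X2 x, Cs X1' e> = <X2 Cf x, X1' e> = <Cf x, w>. Invariance of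
    [D] under [Cf] and its adjoint [Cs] justifies the middle steps. *)
Lemma wmul_bicommutant X1 X2 : M X1 -> M X2 -> wmul_defined K D X1 X2 ->
  bicommutant K D M (wmul K D X1 X2).
Proof.
  intros h1 h2 hd. pose proof (wmul_Ldag X1 X2 h1 h2 hd) as hWL.
  split; auto. intros Cf hC x e v w' hx he hv (_ & hw').
  pose proof hset as (hK & hKc & _ & hDK & hdense).
  destruct hd as (hd1 & hd2).
  destruct (adjoint_exists H K Cf) as (Cs & hCs & hadj); auto; [apply hC|].
  pose proof (commutant_adjoint Cf Cs hC hCs hadj) as hCc.
  destruct (Ldag_dag _ _ _ _ (hL X1 h1) he) as [z hz].
  destruct (hd2 _ _ hz) as [w hw].
  pose proof hv as (y & hy & a1 & a2 & a3).
  assert (hzs : dag K D X1 (Cs e) (Cs z)).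
  { destruct hM as (_ & _ & _ & _ & _ & hdag). destruct (hdag X1 h1) as (X' & hX' & heq).
    apply heq. apply commutant_apply; auto. apply heq; auto. }
  assert (hyC : X2 (Cf x) (Cf y)) by (apply commutant_apply; auto).
  assert (hzK : K z) by apply hz.
  assert (e1 : hinner (Cf v) e = hinner (Cf x) w).
  { rewrite hadj by auto. apply a3 in hzs. apply inner_sym_eq in hzs. rewrite <- hzs.
    rewrite <- hadj by auto. apply hw; auto. }
  rewrite e1. f_equal.
  (* The adjoint of the product is single-valued, and [w] is a value of it at [e]. *)
  apply (adj_fun K D (wmul K D X1 X2) e); auto.
  - intros a ha. apply hWL; auto.
  - split; [auto|]. split; [apply hw|]. intros a b (c & hc & b1 & b2 & b3).
    destruct hw as (_ & _ & hw). rewrite <- (hw _ _ hc). apply inner_sym_eq.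
    symmetry; apply b3; auto.
Qed.

Lemma partial_Oalg_of_bicommutant :
  (forall X, bicommutant K D M X -> inS M X) -> partial_Oalg K D M.
Proof. intro h. split; auto. intros. apply h, wmul_bicommutant; auto. Qed.

End WeakProduct.

Lemma mem_bicommutant K D M X : Ostar_vs K D M -> inS M X -> bicommutant K D M X.
Proof.
  intros hM (Y & hY & heq). split.
  - apply (Ldag_ext K D Y X heq). apply hM; auto.
  - intros Cf (_ & hC) xi e y z hxi he hy hz. apply (hC Y); auto.
    + apply heq; auto.
    + apply (dag_ext _ _ _ _ (op_eq_sym _ _ heq)); auto.
Qed.
End Operators.

(** * Reduction by a projection *)

Section Reduction.
Variable H : HilbertSpace.
#[local] Arguments boundedK {H}.
#[local] Arguments op_closure {H}.
#[local] Arguments inS {H}.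
#[local] Arguments linop {H}.
#[local] Arguments adjK {H}.
#[local] Arguments restr {H}.
#[local] Arguments dag {H}.
#[local] Arguments Ldag {H}.
#[local] Arguments setting {H}.
#[local] Arguments Ostar_vs {H}.
#[local] Arguments Dhat {H}.
#[local] Arguments full_closure {H}.
#[local] Arguments weak_commutant {H}.
#[local] Arguments bicommutant {H}.
#[local] Arguments partial_GW {H}.
#[local] Arguments projection {H}.
#[local] Arguments graph {H}.
#[local] Arguments range {H}.
#[local] Arguments image {H}.
#[local] Arguments reduced {H}.
#[local] Arguments conv {H}.
Implicit Types (x y z : H) (X Y : op H).

Variables (D : H -> Prop) (M : op H -> Prop) (E : H -> H).
(** The Hilbert space of [M] is all of [H], while the reduction lives in the range [K] of [E]. *)
Let T (x : H) := True.
Hypothesis hM : Ostar_vs T D M.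
Hypothesis hinv : forall Cf xi, weak_commutant T D M Cf -> D xi -> D (Cf xi).
Hypothesis hbi : forall X, bicommutant T D M X -> inS M X.
Hypothesis hE : projection E.
Hypothesis hEM : inS M (restr (graph E) D).
Hypothesis hED : forall x, D x -> D (E x).

Let K := range E.
Let D0 := image E D.
Let N := reduced E D M.

Let hset : setting T D. Proof. apply hM. Qed.
Let hL X : M X -> Ldag T D X. Proof. apply hM. Qed.
Let E_sym x y : hinner (E x) y = hinner x (E y). Proof. apply hE. Qed.
Let E_add x y : E (hadd x y) = hadd (E x) (E y). Proof. apply hE; exact I. Qed.
Let E_scal a x : E (hscal a x) = hscal a (E x). Proof. apply hE; exact I. Qed.
Let E_idem x : E (E x) = E x. Proof. apply hE. Qed.

Let E_fix x : K x -> E x = x.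
Proof. intros [y ->]. apply E_idem. Qed.

Let E_range x : K (E x).
Proof. exists x; auto. Qed.

Let D0_fix x : D0 x -> E x = x.
Proof. intros (y & _ & ->). apply E_idem. Qed.

Let D0_D x : D0 x -> D x.
Proof. intros (y & hy & ->). auto. Qed.

Let D0_E x : D x -> D0 (E x).
Proof. exists x; auto. Qed.

Let subspace_T : subspace H T.
Proof. apply hset. Qed.

Let E0 : E hzero = hzero.
Proof. apply (bounded_zero H T); auto. apply hE. Qed.

Lemma E_conv u x : conv u x -> conv (fun n => E (u n)) (E x).
Proof. apply (bounded_conv H T); unfold T; auto. apply hE. Qed.

(** The range is closed as the fixed point set of the continuous [E]; and [E] maps a sequence in [D]
    converging to a point of the range to a sequence in [D0] with the same limit. *)
Lemma range_setting : setting K D0.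
Proof.
  pose proof hset as (_ & _ & (Dz & Da & Ds) & _ & hd).
  split; [|split; [|split; [|split]]].
  - split; [|split].
    + exists hzero; auto.
    + intros x y [a ->] [b ->]. exists (hadd a b). auto.
    + intros k x [a ->]. exists (hscal k a); auto.
  - apply closed_set_conv. intros u x hu hc. exists x.
    apply (conv_unique H u); auto. apply E_conv in hc.
    intros e he. destruct (hc e he) as [n hn]. exists n; intros i hi.
    rewrite <- (E_fix (u i) (hu i)). auto.
  - split; [|split].
    + exists hzero; auto.
    + intros x y (a & ha & ->) (b & hb & ->). exists (hadd a b). auto.
    + intros k x (a & ha & ->). exists (hscal k a); auto.
  - intros x (a & _ & ->). apply E_range.
  - apply conv_dense. intros x hx.
    destruct (dense_conv H T D x hd I) as (u & hu & hc).
    exists (fun n => E (u n)). split; [auto|]. rewrite <- (E_fix x hx). apply E_conv; auto.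
Qed.

(** A concrete graph for one member of [N], which [reduced] describes only up to equality of
    graphs. *)
Definition compress (X : op H) : op H := fun xi z => D0 xi /\ exists y, X xi y /\ z = E y.

Lemma compress_mem X : inS M X -> N (compress X).
Proof.
  intros (Y & hY & heq). exists Y; split; auto.
  intros x z; split; intros (hx & y & hy & hz); (split; [auto|]); exists y; split; auto; apply heq; auto.
Qed.

(** [E] is symmetric and fixes [D0], so <E X x, e> = <X x, e> = <x, z> = <x, E z>. *)
Lemma compress_dag_adj X e z : D0 e -> dag T D X e z -> adjK K (compress X) e (E z).
Proof.
  intros he (_ & _ & _ & h). split; [rewrite <- (D0_fix e he); apply E_range|].
  split; [apply E_range|]. intros x y (hx & y' & hy & ->).
  rewrite E_sym, (D0_fix e he), (h _ _ hy), <- E_sym, (D0_fix x hx). reflexivity.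
Qed.

Lemma compress_val X x : M X -> D0 x -> opdom H (compress X) x.
Proof.
  intros hX hx. destruct (Ldag_val _ _ _ _ _ (hL X hX) (D0_D x hx)) as [y hy].
  exists (E y). split; auto. exists y; auto.
Qed.

(** One inclusion is the preceding computation; the other holds because adjoints are single-valued
    and the dagger of [X] is defined on all of [D0]. Through this, [N] inherits the involution of
    [M]. *)
Lemma compress_dag X e z : M X -> dag K D0 (compress X) e z <-> compress (dag T D X) e z.
Proof.
  intro hX. split.
  - intros (he & hz). split; auto.
    destruct (Ldag_dag _ _ _ _ _ (hL X hX) (D0_D e he)) as [w hw].
    exists w; split; auto.
    apply (adj_fun H K D0 (compress X) e); auto using range_setting, compress_dag_adj.
    intros; apply compress_val; auto.
  - intros (he & w & hw & ->). split; auto using compress_dag_adj.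
Qed.

Lemma compress_Ldag X : M X -> Ldag K D0 (compress X).
Proof.
  intro hX. assert (hlin : linop X) by (apply hL; auto).
  destruct hlin as (l1 & l2 & l3 & l4).
  pose proof range_setting as (_ & _ & (Dz & Da & Ds) & _ & _).
  split; [|split; [|split]].
  - intro x; split; [intros (y & hx & _); auto | intro hx; apply compress_val; auto].
  - split; [|split; [|split]].
    + intros x y y' (_ & a & ha & ->) (_ & b & hb & ->). f_equal. eauto.
    + split; auto. exists hzero; auto.
    + intros x y x' y' (hx & a & ha & ->) (hx' & b & hb & ->). split; auto.
      exists (hadd a b); auto.
    + intros k x y (hx & a & ha & ->). split; auto. exists (hscal k a); auto.
  - intros x y (_ & a & _ & ->). apply E_range.
  - intros e he. destruct (Ldag_dag _ _ _ _ _ (hL X hX) (D0_D e he)) as [w hw].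
    exists (E w). apply compress_dag_adj; auto.
Qed.

Lemma reduced_Ostar : Ostar_vs K D0 N.
Proof.
  destruct hM as (_ & _ & hz & ha & hs & hd).
  split; [apply range_setting|]. split; [|split; [|split; [|split]]].
  - intros Y (X & hX & heq). apply (Ldag_ext H K D0 _ _ (op_eq_sym _ _ _ heq)).
    apply compress_Ldag; auto.
  - exists (compress (op_zero H D)). split; [apply compress_mem; auto|].
    intros x z; split.
    + intros (hx & y & (_ & ->) & ->). split; auto.
    + intros (hx & ->). split; auto. exists hzero. split; auto. split; auto.
  - intros X' Y' (X & hX & hX') (Y & hY & hY').
    exists (compress (op_add H X Y)). split; [apply compress_mem; auto|].
    intros x z; split.
    + intros (hx & y & (a & b & h1 & h2 & ->) & ->). exists (E a), (E b).
      split; [apply hX'; split; eauto|]. split; [apply hY'; split; eauto|]. auto.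
    + intros (a & b & h1 & h2 & ->). apply hX' in h1 as (hx & a' & h1 & ->).
      apply hY' in h2 as (_ & b' & h2 & ->). split; auto.
      exists (hadd a' b'). split; auto. exists a', b'; auto.
  - intros k X' (X & hX & hX').
    exists (compress (op_scal H k X)). split; [apply compress_mem; auto|].
    intros x z; split.
    + intros (hx & y & (a & h1 & ->) & ->). exists (E a).
      split; [apply hX'; split; eauto|]. auto.
    + intros (a & h1 & ->). apply hX' in h1 as (hx & a' & h1 & ->). split; auto.
      exists (hscal k a'). split; auto. exists a'; auto.
  - intros X' (X & hX & hX').
    exists (compress (dag T D X)). split; [apply compress_mem; auto|].
    intros x z; split; intro h.
    + apply (dag_ext H K D0 _ _ (op_eq_sym _ _ _ hX')). apply compress_dag; auto.
    + apply compress_dag; auto. apply (dag_ext H K D0 _ _ hX'). auto.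
Qed.

(** [E] restricted to [D] belongs to [M], so [S] commutes with it there; density of [D] and
    boundedness give all of [H]. *)
Lemma commutant_E S x : weak_commutant T D M S -> S (E x) = E (S x).
Proof.
  intro hS. pose proof hS as (hb & _). pose proof hset as (_ & _ & _ & _ & hd).
  destruct hEM as (X & hX & heq).
  assert (hDx : forall x, D x -> S (E x) = E (S x)).
  { intros y hy. assert (hXy : X y (E y)) by (apply heq; split; [auto | reflexivity]).
    apply (commutant_apply H T D M hM hinv S) in hXy; auto.
    apply heq in hXy as (_ & h). exact h. }
  destruct (dense_conv H T D x hd I) as (u & hu & hc).
  apply (conv_unique H (fun n => S (E (u n)))).
  - apply (bounded_conv H T S (fun n => E (u n))); unfold T; auto. apply E_conv; auto.
  - assert (hc' : conv (fun n => E (S (u n))) (E (S x))).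
    { apply (E_conv (fun n => S (u n))). apply (bounded_conv H T); unfold T; auto. }
    intros e he. destruct (hc' e he) as [n hn]. exists n; intros i hi. rewrite hDx; auto.
Qed.

(** [S] preserves [D] and commutes with [E] and with every member of [M], so acting on both
    coordinates it maps the graph of [Y] into itself, and by boundedness also the closure. *)
Lemma commutant_closure S Y x y :
  weak_commutant T D M S -> N Y -> op_closure Y x y -> op_closure Y (S x) (S y).
Proof.
  intros hS (X & hX & heq) h. apply closureE in h as (u & v & huv & hu & hv).
  apply closureE. exists (fun n => S (u n)), (fun n => S (v n)).
  assert (hb : boundedK T S) by apply hS.
  split; [|split; apply (bounded_conv H T); unfold T; auto].
  intro n. destruct (proj1 (heq _ _) (huv n)) as (hn & w & hw & ->).
  apply heq. split.
  - rewrite <- (D0_fix _ hn), commutant_E by auto. apply D0_E. apply hinv; auto.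
  - exists (S w). split; [|apply commutant_E; auto].
    apply (commutant_apply H T D M hM hinv S); auto.
Qed.

(** Commuting with [E], [S] leaves the range of [E] invariant, and [E] may be inserted or removed
    next to vectors of [D0]. *)
Lemma commutant_restrict S : weak_commutant T D M S -> weak_commutant K D0 N S.
Proof.
  intro hS. pose proof hS as ((_ & Sa & Ss & c & hc) & hcom). split.
  - split; [|split; [|split; [|exists c]]]; unfold T in *; auto.
    intros x hx. rewrite <- (E_fix x hx), commutant_E by auto. apply E_range.
  - intros Y xi e y z (X & hX & heq) hxi he hy hz.
    apply heq in hy as (_ & y' & hy' & ->).
    apply (dag_ext H K D0 _ _ heq) in hz. apply compress_dag in hz as (_ & z' & hz' & ->); auto.
    rewrite commutant_E, E_sym, (D0_fix e he), <- E_sym, <- commutant_E, (D0_fix xi hxi) by auto.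
    apply (hcom X); auto.
Qed.

(* The entries of the projection onto the closed graph of [Y] commute with the weak
   commutant of [M], so by the bicommutant condition they lie in [M] and are therefore
   seen by [Cf]. *)
Lemma reduced_commutant_closure Cf Y x y :
  weak_commutant K D0 N Cf -> N Y -> op_closure Y x y -> op_closure Y (Cf x) (Cf y).
Proof.
  intros hC hY hxy. pose proof range_setting as hKs.
  pose proof hKs as (hK & hKc & _ & hDK & hdK).
  assert (hYL : Ldag K D0 Y) by (apply reduced_Ostar; auto).
  assert (hlin : linop Y) by apply hYL.
  (* The closed graph of [Y] as a closed subspace of the Hilbert sum. *)
  set (V := fun p : prodH H => op_closure Y (fst p) (snd p)).
  destruct (orthogonal_projection (prodH H) V) as (P & hPb & hPV & hPs & hPu).
  { split; [|split].
    - apply closure_incl. apply hlin.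
    - intros p q hp hq. apply closure_add; auto.
    - intros a p hp. apply closure_scal; auto. }
  { apply closed_set_conv. intros u p hu hc. apply conv_pair in hc as [h1 h2].
    apply (closure_idem H (fun a b => op_closure Y a b) Y); auto.
    apply closureE. exists (fun n => fst (u n)), (fun n => snd (u n)). auto. }
  assert (hPfix : forall p, V p -> P p = p).
  { intros p hp. apply hPu; auto. intros v _. rewrite inner_subl. C_ring. }
  set (q := fun a b x => pout H b (P (pin H a x))).
  assert (qK : forall a b x, K (q a b x)).
  { intros a b z. destruct (Ldag_closure_K H K D0 Y _ _ hKs hYL (hPV (pin H a z))).
    unfold q. destruct b; auto. }
  assert (qsym : forall a b x y, hinner (q a b x) y = hinner x (q b a y))
    by (intros; apply compression_sym; auto).
  assert (qb : forall a b, boundedK T (q a b))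
    by (intros; apply compression_bounded; auto).
  assert (qS : forall S, weak_commutant T D M S -> forall a b x, q a b (S x) = S (q a b x)).
  { intros S hS. pose proof hset as (hT & hTc & _).
    assert (hSb : boundedK T S) by apply hS.
    destruct (adjoint_exists H T S) as (Ss & hSs & hadj); auto.
    assert (hScom : weak_commutant T D M Ss) by (apply (commutant_adjoint H T D M hM S); auto).
    (* [V] is invariant under the diagonal actions of [S] and of its adjoint [Ss], hence [S] also
       preserves the orthogonal complement; uniqueness of the decomposition then gives commutation
       with [P]. *)
    assert (hP : forall p, P (S (fst p), S (snd p)) = (S (fst (P p)), S (snd (P p)))).
    { intro p. apply hPu.
      - apply commutant_closure; auto. apply hPV.
      - intros v hv.
        set (w := (Ss (fst v), Ss (snd v)) : prodH H).
        assert (hw : P w = w) by (apply hPfix; apply commutant_closure; auto).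
        assert (h0 : hinner (hsub (prodH H) p (P p)) w = C0).
        { rewrite inner_subl, hPs, hw. C_ring. }
        rewrite <- h0. rewrite !inner_subl. simpl. unfold pinner; simpl.
        rewrite !hadj by exact I. reflexivity. }
    intros a b z. unfold q.
    assert (S0 : S hzero = hzero) by (apply (bounded_zero H T); auto).
    replace (pin H a (S z)) with ((S (fst (pin H a z)), S (snd (pin H a z))) : prodH H).
    - rewrite hP. destruct b; reflexivity.
    - destruct a; apply pair_ext; simpl; auto. }
  assert (qC : forall a b x, K x -> q a b (Cf x) = Cf (q a b x)).
  { intros a b.
    assert (qadj : forall a b e, D e -> dag T D (restr (graph (q a b)) D) e (q b a e)).
    { intros a' b' e he. split; [auto|]. split; [exact I|]. split; [exact I|].
      intros xi z (_ & ->). apply qsym. }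
    assert (qL : Ldag T D (restr (graph (q a b)) D)).
    { pose proof hset as (_ & _ & (Dz & Da & Ds) & _).
      destruct (qb a b) as (_ & qa & qs & _). split; [|split; [|split]].
      - intro z; split; [intros (w & hz & _); auto|]. intro hz. exists (q a b z). split; [auto | reflexivity].
      - split; [|split; [|split]].
        + intros z w w' (_ & ->) (_ & ->); auto.
        + split; auto. symmetry. apply (bounded_zero H T); auto.
        + intros z w z' w' (hz & ->) (hz' & ->). split; auto. symmetry. apply qa; exact I.
        + intros k z w (hz & ->). split; auto. symmetry. apply qs; exact I.
      - intros; exact I.
      - intros e he. exists (q b a e). apply (qadj a b e he). }
    assert (qM : inS M (restr (graph (q a b)) D)).
    { apply hbi. split; auto. intros S hS xi e w z hxi he (_ & ->) hz.
      replace z with (q b a e).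
      - rewrite <- qS by auto. apply qsym.
      - apply (adj_fun H T D (restr (graph (q a b)) D) e); auto; [|apply qadj; auto|apply hz].
        intros t ht. exists (q a b t). split; [auto | reflexivity]. }
    (* The entries have values in [K], so compressing them by [E] leaves their values unchanged, and
       the weak relation of [Cf] with these members of [N] becomes commutation on [D0]. Density
       extends it to [K]. *)
    assert (h0 : forall z, D0 z -> q a b (Cf z) = Cf (q a b z)).
    { intros z hz. destruct hC as ((CK & _) & hcom).
      apply (dense_eq H K D0); auto. intros e he.
      rewrite qsym. symmetry.
      apply (hcom (compress (restr (graph (q a b)) D))); auto.
      - apply compress_mem; auto.
      - split; auto. exists (q a b z). split; [split; [auto | reflexivity]|].
        symmetry. apply E_fix; auto.
      - split; [auto|]. split; [auto|]. split; [auto|].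
        intros xi w (hxi & w' & (_ & ->) & ->).
        unfold graph. rewrite E_fix by auto. apply qsym. }
    intros z hz. destruct (dense_conv H K D0 z hdK hz) as (u & hu & hc).
    assert (hCb : boundedK K Cf) by apply hC.
    apply (conv_unique H (fun n => q a b (Cf (u n)))).
    - apply (bounded_conv H T (q a b) (fun n => Cf (u n))); unfold T; auto.
      apply (bounded_conv H K); auto.
    - assert (hc' : conv (fun n => Cf (q a b (u n))) (Cf (q a b z))).
      { apply (bounded_conv H K Cf (fun n => q a b (u n))); auto.
        apply (bounded_conv H T (q a b) u); unfold T; auto. }
      intros e he. destruct (hc' e he) as [n hn]. exists n; intros i hi. rewrite h0; auto. }
  (* Recovers [P] from its four entries by splitting a pair into its coordinates. *)
  assert (hPq : forall b a c, pout H b (P (a, c)) = hadd (q true b a) (q false b c)).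
  { intros b a c. unfold q. rewrite <- pout_add. destruct hPb as (_ & Pa & _).
    rewrite <- Pa by exact I. f_equal. f_equal. symmetry. apply (pin_pout H (a, c)). }
  destruct (Ldag_closure_K H K D0 Y x y hKs hYL hxy) as [hx hy].
  assert (hfix : P (x, y) = (x, y)) by (apply hPfix; exact hxy).
  (* [Cf] commutes with the entries, so [P] fixes the image of a pair it fixes, and that image
     therefore lies in [V]. *)
  assert (hfixC : P (Cf x, Cf y) = (Cf x, Cf y)).
  { destruct hC as ((_ & Ca & _) & _).
    apply pair_ext; simpl.
    - change (pout H true (P (Cf x, Cf y)) = Cf x).
      rewrite hPq, !qC, <- Ca, <- hPq, hfix by auto. reflexivity.
    - change (pout H false (P (Cf x, Cf y)) = Cf y).
      rewrite hPq, !qC, <- Ca, <- hPq, hfix by auto. reflexivity. }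
  pose proof (hPV (Cf x, Cf y)) as hv. rewrite hfixC in hv. exact hv.
Qed.

Lemma full_closure_bicommutant X :
  bicommutant K (Dhat N) (full_closure N) X -> inS (full_closure N) X.
Proof.
  intros (hX & hcom). pose proof reduced_Ostar as hN.
  pose proof (Dhat_setting H K D0 N hN) as hds.
  pose proof hX as (hdom & (l1 & l2 & l3 & l4) & hXK & hXa).
  pose proof hset as (_ & _ & (Dz & Da & Ds) & _).
  pose proof hds as (hK & _ & _ & hDK & hdense).
  assert (hDE : forall x, D x -> Dhat N (E x)) by (intros; apply (Dhat_incl H K D0 N hN); auto).
  set (Y := fun x y => D x /\ X (E x) y).
  assert (Yval : forall x, D x -> exists y, Y x y).
  { intros x hx. destruct (Ldag_val _ _ _ _ _ hX (hDE x hx)) as [y hy]. exists y; split; auto. }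
  (* [X] and its adjoint take values in [K], so <X E x, e> = <X E x, E e> = <E x, z> = <x, z>. *)
  assert (Yadj : forall e z, D e -> adjK K X (E e) z -> adjK T Y e z).
  { intros e z he (_ & hz & h). split; [exact I|]. split; [exact I|]. intros x y (hx & hy).
    rewrite <- (E_fix y), E_sym, (h _ _ hy), E_sym, (E_fix z) by eauto. reflexivity. }
  assert (hY : bicommutant T D M Y).
  { split.
    - split; [|split; [|split]].
      + intro x; split; [intros (y & hx & _); auto | apply Yval].
      + split; [|split; [|split]].
        * intros x y y' (_ & h) (_ & h'). eauto.
        * split; auto. rewrite E0. auto.
        * intros x y x' y' (hx & h) (hx' & h'). split; auto. rewrite E_add; auto.
        * intros k x y (hx & h). split; auto. rewrite E_scal; auto.
      + intros; exact I.
      + intros e he. destruct (hXa (E e) (hDE e he)) as [z hz]. exists z; auto.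
    - intros S hS xi e y z hxi he (_ & hy) (_ & hz).
      (* [S] lies in the weak commutant of [N], hence in that of its full closure, so the assumption
         on [X] applies at [E xi] and [E e]. *)
      pose proof (commutant_restrict S hS) as hSN.
      apply (full_closure_commutant H K D0 N hN) in hSN.
      destruct (Ldag_dag _ _ _ _ _ hX (hDE e he)) as [w hw].
      assert (hwK : K w) by apply hw.
      replace z with w.
      + rewrite <- (E_fix y), commutant_E, E_sym by eauto.
        rewrite (hcom S hSN (E xi) (E e) y w); auto.
        rewrite commutant_E, E_sym, (E_fix w) by auto. reflexivity.
      + apply (adj_fun H T D Y e); auto. apply Yadj; auto. apply hw. }
  destruct (hbi Y hY) as (Y0 & hY0 & heq).
  exists (restr (op_closure (compress Y0)) (Dhat N)).
  assert (hNc : N (compress Y0)) by (exists Y0; split; [auto | intros a b; reflexivity]).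
  split; [apply full_closure_mem; auto|].
  (* [compress Y0] is [X] restricted to [D0], so adjoint values of [X] are adjoint values of
     [compress Y0]; pairing with the dense [Dhat N] identifies [X] with the closure wherever both
     are defined. *)
  assert (key : forall x y z, X x y -> op_closure (compress Y0) x z -> y = z).
  { intros x y z hy hz.
    apply (dense_eq H K (Dhat N)); eauto.
    - apply (Ldag_closure_K H K D0 (compress Y0) x z); auto using range_setting, compress_Ldag.
    - intros e he. destruct (Ldag_dag _ _ _ _ _ hX he) as (w & _ & h1 & h2 & h3).
      rewrite (h3 _ _ hy). symmetry. apply (closure_adj H K (compress Y0) x z); auto.
      split; [auto|]. split; [auto|]. intros a b (ha & b' & hb & ->).
      apply heq in hb as (_ & hb). rewrite (E_fix b') by eauto.
      rewrite (D0_fix a ha) in hb. auto. }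
  intros x y; split.
  - intros (hx & hy). destruct (Ldag_val _ _ _ _ _ hX hx) as [y' hy'].
    rewrite <- (key x y' y); auto.
  - intro hy. assert (hx : Dhat N x) by (eapply Ldag_dom; eauto). split; auto.
    destruct (hx _ hNc) as [z hz]. rewrite (key x y z); auto.
Qed.

Lemma full_closure_reduced_GW : partial_GW K (Dhat N) (full_closure N).
Proof.
  pose proof reduced_Ostar as hN.
  pose proof (full_closure_Ostar H K D0 N hN) as hF.
  assert (hi : forall Cf xi, weak_commutant K (Dhat N) (full_closure N) Cf ->
            Dhat N xi -> Dhat N (Cf xi)).
  (* [Cf] preserves the domain of the closure of each [Y] in [N], hence the intersection of these
     domains. *)
  { intros Cf xi hC hxi Y hY. apply (full_closure_commutant H K D0 N hN) in hC.
    destruct (hxi Y hY) as [y hy]. exists (Cf y). apply reduced_commutant_closure; auto. }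
  split; [|split; [|split]].
  - apply partial_Oalg_of_bicommutant; auto. apply full_closure_bicommutant.
  - apply (full_closure_fully_closed H N).
  - exact hi.
  - intro X; split; [apply mem_bicommutant; auto | apply full_closure_bicommutant].
Qed.
End Reduction.

Theorem theorem2p3 (H : HilbertSpace) (D : H -> Prop) (M : op H -> Prop) (E : H -> H) :
  subspace H D -> dense_in H (fun _ => True) D ->
  partial_GW H (fun _ => True) D M ->
  projection H E ->
  inS H M (restr H (graph H E) D) ->
  (forall x, D x -> D (E x)) ->
  partial_GW H (range H E) (Dhat H (reduced H E D M))
    (full_closure H (reduced H E D M)).
Proof.
  intros _ _ ((hM & _) & _ & hinv & hbi) hE hEM hED.
  apply full_closure_reduced_GW; auto. intros X hX. apply hbi; auto.
Qed.
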